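(* Let $X$ be a Banach space with $\mathrm{dens}(X)=\omega_1$. Then the following are equivalent: (a) $X$ is weakly compactly generated and $X$ admits an equivalent norm which is Lipschitz weak-star Kadec-Klee (i.e. $c$-Lipschitz weak-star Kadec-Klee for some $c\in(0,1]$); (b) $X$ is linearly isomorphic to a closed subspace of $c_0(\Gamma)$ for some set $\Gamma$ with $|\Gamma|=\omega_1$.
   Context: $\mathrm{dens}(X)$ is the density character (smallest cardinality of a dense subset). For $c\in(0,1]$, the norm of a separable Banach space $Z$ is $c$-Lipschitz weak-star Kadec-Klee if for every $z^*\in Z^*$ and every weak$^*$-null sequence $(z_n^* )$ in $Z^*$, $\limsup_n\|z^*+z_n^*\|\ge\|z^*\|+c\limsup_n\|z_n^*\|$; the norm of an arbitrary Banach space is $c$-Lipschitz weak-star Kadec-Klee if its restriction to every separable closed subspace has this property. $X$ is weakly compactly generated if it contains a weakly compact subset whose linear span is dense. $c_0(\Gamma)$ is the space of real functions on $\Gamma$ vanishing at infinity, with the sup norm. *)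

(* Defs.v *)
From HB Require Import structures.
From mathcomp Require Import all_boot all_order all_algebra.
From mathcomp Require Import all_classical all_reals all_analysis.
Set Implicit Arguments. Unset Strict Implicit. Unset Printing Implicit Defensive.
Import Order.TTheory GRing.Theory Num.Theory.
Import numFieldNormedType.Exports.
Local Open Scope classical_set_scope.
Local Open Scope ring_scope.

Definition card_omega1 (G : Type) : Prop :=
  ~ countable [set: G] /\
  exists lt : G -> G -> Prop,
    well_founded lt /\
    (forall x y z, lt x y -> lt y z -> lt x z) /\
    (forall x y, lt x y \/ x = y \/ lt y x) /\
    (forall g, countable [set h | lt h g]).

Section Banach.
Context {R : realType} {X : normedModType R}.

Definition dense_in (D : set X) : Prop :=
  forall x (e : R), 0 < e -> exists d, D d /\ `|x - d| < e.

Definition separable_set (Z : set X) : Prop :=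
  exists D : set X, countable D /\ D `<=` Z /\
    forall z (e : R), Z z -> 0 < e -> exists d, D d /\ `|z - d| < e.

Definition density_omega1 : Prop :=
  ~ (exists D : set X, countable D /\ dense_in D) /\
  exists (G : Type) (d : G -> X), card_omega1 G /\ dense_in (range d).

Definition is_linear_fun (f : X -> R) : Prop :=
  forall (a : R) (x y : X), f (a *: x + y) = a * f x + f y.

Definition is_clf (f : X -> R) : Prop := is_linear_fun f /\ continuous f.

Definition weakly_open (U : set X) : Prop :=
  forall x, U x -> exists (n : nat) (f : 'I_n -> X -> R) (e : R),
    (forall i, is_clf (f i)) /\ 0 < e /\
    [set y | forall i, `|f i y - f i x| < e] `<=` U.

Definition weakly_compact (K : set X) : Prop :=
  forall (I : Type) (U : I -> set X),
    (forall i, weakly_open (U i)) -> K `<=` \bigcup_i U i ->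
    exists F : set I, finite_set F /\ K `<=` \bigcup_(i in F) U i.

Definition lin_span (K : set X) : set X :=
  [set x | exists (n : nat) (a : 'I_n -> R) (v : 'I_n -> X),
     (forall i, K (v i)) /\ x = \sum_(i < n) a i *: v i].

Definition WCG : Prop :=
  exists K : set X, weakly_compact K /\ dense_in (lin_span K).

Definition equiv_norm (N : X -> R) : Prop :=
  (forall x y, N (x + y) <= N x + N y) /\
  (forall (a : R) x, N (a *: x) = `|a| * N x) /\
  exists c1 c2 : R, 0 < c1 /\ 0 < c2 /\
    forall x, c1 * `|x| <= N x /\ N x <= c2 * `|x|.

Definition closed_subspace (Z : set X) : Prop :=
  Z 0 /\ (forall (a : R) x y, Z x -> Z y -> Z (a *: x + y)) /\ closed Z.

(* phi (restricted to Z) is an element of Z^* (Z normed by N) *)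
Definition in_dual (N : X -> R) (Z : set X) (phi : X -> R) : Prop :=
  (forall (a : R) x y, Z x -> Z y -> phi (a *: x + y) = a * phi x + phi y) /\
  exists M : R, forall z, Z z -> `|phi z| <= M * N z.

Definition dual_norm (N : X -> R) (Z : set X) (phi : X -> R) : \bar R :=
  ereal_sup [set (`|phi z|)%:E | z in [set z | Z z /\ N z <= 1]].

Definition LwsKK (N : X -> R) (c : R) : Prop :=
  forall Z : set X, closed_subspace Z -> separable_set Z ->
  forall (phi : X -> R) (phin : nat -> X -> R),
    in_dual N Z phi -> (forall n, in_dual N Z (phin n)) ->
    (forall z, Z z -> (fun n => phin n z) @ \oo --> (0 : R)) ->
    (dual_norm N Z phi + c%:E * limn_esup (fun n => dual_norm N Z (phin n))
      <= limn_esup (fun n => dual_norm N Z (fun x => (phi x + phin n x)%R)))%E.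

End Banach.

Section C0.
Context {R : realType} {G : Type}.

Definition in_c0 (f : G -> R) : Prop :=
  forall e : R, 0 < e -> finite_set [set g | e <= `|f g|].

Definition supnorm (f : G -> R) : R := sup [set `|f g| | g in [set: G]].

End C0.

(* X is linearly isomorphic to a closed subspace of c_0(G):
   a linear T : X -> c_0(G) that is bounded and bounded below
   (an isomorphism onto its range T(X), which is then closed). *)
Definition iso_into_c0 {R : realType} (X : normedModType R) (G : Type) : Prop :=
  exists T : X -> G -> R,
    (forall x, in_c0 (T x)) /\
    (forall (a : R) (x y : X), T (a *: x + y) = (fun g => a * T x g + T y g)) /\
    (exists a b : R, 0 < a /\ 0 < b /\
       forall x, a * `|x| <= supnorm (T x) /\ supnorm (T x) <= b * `|x|).

(* Main.v *)
Require Import Defs.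
From HB Require Import structures.
From mathcomp Require Import all_boot all_order all_algebra.
From mathcomp Require Import all_classical all_reals all_analysis.
From mathcomp Require Import ring lra.
Set Implicit Arguments. Unset Strict Implicit. Unset Printing Implicit Defensive.
Import Order.TTheory GRing.Theory Num.Theory.
Import numFieldNormedType.Exports.
Local Open Scope classical_set_scope.
Local Open Scope ring_scope.

(* (b) => (a).  Let T embed X into c_0(G), and give X the norm |T x|.  If phi_n is
   weak*-null, half the difference of almost norming vectors z_n of phi_n and z_m of phi_m
   that almost agree on the finitely many large coordinates of a vector z can be added
   to z almost without increasing the norm; this gives the Kadec-Klee inequality with
   constant 1/2.  Call A invariant if X is stable under restriction to A.  Invariant sets
   form a complete Boolean algebra, and averaging elements with disjoint large
   coordinates shows that every point lies in a countable invariant set.  Hence X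
   is the c_0-sum of the separable pieces supported by the atoms, and dense sequences
   of the pieces, scaled to 0, form with 0 a generating weakly compact set.

   (a) => (b).  Separable case: by the Kadec-Klee inequality each e in a dual ball has a
   weak* neighbourhood e + W with |e + g| >= |e| + c |g| - delta for g in W, and finitely
   many of these cover the ball.  Iterating, each f is a weak* sum of e_j, with e_j in
   a fixed finite set E_j and c * sum |e_j| <= |f| + small; the normalised E_j form a
   weak*-null sequence that norms X up to a constant.  In general, close off
   countable sets of vectors and functionals under Skolem functions; weak compactness
   turns each closed-off pair (D, Phi) into a contractive projection onto cl D with
   kernel Phi^perp, and the Kadec-Klee inequality on cl D, applied to elements of Phi that
   imitate f on D, gives N (y + w) <= max (N y) (2/c N w) for y in the range and w in
   the kernel.  Along an omega_1-chain this bounds N x by the norms of the separable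
   blocks of x, which are embedded by the separable case. *)

(** * Hahn-Banach *)

Section HahnBanach.
Context {R : realType} {V : lmodType R}.
Variable p : V -> R.
Hypothesis p_add : forall x y, p (x + y) <= p x + p y.
Hypothesis p_scale : forall (a : R) x, p (a *: x) = `|a| * p x.

(* A linear functional on a subspace is represented by its graph, a subspace of
   [V * R]; domination by [p] makes such a subspace single-valued. *)
Definition dominated_graph (g : set (V * R)) : Prop :=
  (forall (a : R) x r y s, g (x, r) -> g (y, s) -> g (a *: x + y, a * r + s)) /\
  (forall x r, g (x, r) -> r <= p x).

Lemma dominated_graph_fun g x r s :
  dominated_graph g -> g (x, r) -> g (x, s) -> r = s.
Proof.
move=> [gl gp] gr gs.
have p0 : p 0 = 0 by rewrite -(scale0r 0) p_scale normr0 mul0r.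
have := gp _ _ (gl (-1) _ _ _ _ gr gs).
have := gp _ _ (gl (-1) _ _ _ _ gs gr).
rewrite scaleN1r addNr p0; lra.
Qed.

(** A value at [v] is admissible when it lies above every [r - p (x - v)] and below every
    [p (y + v) - s]. Subadditivity puts all the lower bounds below all the upper ones, so the
    supremum [al] of the former works. *)
Lemma dominated_graph_extend (g : set (V * R)) (v : V) :
  dominated_graph g -> g (0, 0) ->
  exists g', [/\ dominated_graph g', g `<=` g' & exists r, g' (v, r)].
Proof.
move=> [gl gp] g0.
have gpN x r t : g (x, r) -> - t * r <= p (- t *: x).
  move=> gx; have := gp _ _ (gl (- t) _ _ _ _ gx g0).
  by rewrite !addr0.
pose A : set R := [set u | exists x r, g (x, r) /\ u = r - p (x - v)].
have Aub y s : g (y, s) -> ubound A (p (y + v) - s).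
  move=> gy _ [x [r [gx ->]]].
  have := gp _ _ (gl 1 _ _ _ _ gx gy).
  rewrite scale1r mul1r => h.
  have := p_add (x - v) (y + v).
  have -> : x - v + (y + v) = x + y by rewrite addrACA addNr addr0.
  lra.
have A0 : A !=set0 by exists (0 - p (0 - v)), 0, 0.
have As : has_sup A by split => //; exists (p (0 + v) - 0); exact: Aub.
set al := sup A.
have al_le y s : g (y, s) -> al <= p (y + v) - s.
  by move=> gy; apply: ge_sup => //; exact: Aub.
have al_ge x r : g (x, r) -> r - p (x - v) <= al.
  by move=> gx; apply: (ub_le_sup (proj2 As)); exists x, r.
exists [set z | exists x r t, g (x, r) /\ z = (x + t *: v, r + t * al)].
split; last 2 first.
- by move=> [x r] gx; exists x, r, 0; rewrite scale0r mul0r !addr0.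
- by exists al, 0, 0, 1; rewrite scale1r mul1r !add0r.
split.
- move=> a x r y s [x' [r' [t [gx [-> ->]]]]] [y' [s' [u [gy [-> ->]]]]].
  exists (a *: x' + y'), (a * r' + s'), (a * t + u); split; first exact: gl.
  by rewrite scalerDr scalerA scalerDl addrACA; congr pair; ring.
- move=> x r [x' [r' [t [gx [-> ->]]]]].
  (* Division by [|t|] reduces to the coefficients -1 and 1, which are the two inequalities that
     characterise [al]. *)
  have [t0|t0|->] := ltgtP t 0; last by rewrite scale0r mul0r !addr0; exact: gp.
  + have nt : 0 < - t by rewrite oppr_gt0.
    have := al_ge _ _ (gl (- t)^-1 _ _ _ _ gx g0); rewrite !addr0 => h.
    have -> : x' + t *: v = (- t) *: ((- t)^-1 *: x' - v).
      rewrite scalerBr scalerA divff ?gt_eqF// scale1r scaleNr opprK //.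
    rewrite p_scale gtr0_norm//.
    have : (- t) * ((- t)^-1 * r' - p ((- t)^-1 *: x' - v)) <= (- t) * al.
      by rewrite ler_pM2l.
    rewrite mulrBr mulrA divff ?gt_eqF// mul1r; lra.
  + have := al_le _ _ (gl t^-1 _ _ _ _ gx g0); rewrite !addr0 => h.
    have -> : x' + t *: v = t *: (t^-1 *: x' + v).
      by rewrite scalerDr scalerA divff ?gt_eqF// scale1r.
    rewrite p_scale gtr0_norm//.
    have : t * al <= t * (p (t^-1 *: x' + v) - t^-1 * r') by rewrite ler_pM2l.
    rewrite mulrBr [X in _ - X]mulrA divff ?gt_eqF// mul1r; lra.
Qed.

(** Zorn's lemma gives a maximal dominated graph above [g0], and one-step extension makes it total.
    As [p] is symmetric, domination of [f] also bounds [- f]. *)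
Theorem hahn_banach (g0 : set (V * R)) :
  dominated_graph g0 -> g0 (0, 0) ->
  exists f : V -> R, [/\ forall a x y, f (a *: x + y) = a * f x + f y,
    forall x r, g0 (x, r) -> f x = r & forall x, `|f x| <= p x].
Proof.
move=> dg0 g00.
pose P : set (set (V * R)) :=
  [set g | g = set0 \/ (g0 `<=` g /\ dominated_graph g)].
have [F FP Ft|g [Pg gmax]] := @Zorn_bigcup _ P.
- have [[g [Fg gn]]|noF] := pselect (exists g, F g /\ g !=set0); last first.
    left; apply/seteqP; split=> // z [g Fg gz]; apply: noF.
    by exists g; split=> //; exists z.
  have Pn h z : F h -> h z -> g0 `<=` h /\ dominated_graph h.
    by move=> Fh hz; case: (FP _ Fh) => // h0; move: hz; rewrite h0.
  right; split.
    by case: gn => z gz z' /(proj1 (Pn _ _ Fg gz)); exists g.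
  split=> [a x r y s [h Fh hx] [k Fk ky]|x r [h Fh hx]].
    have [hk|kh] := Ft _ _ Fh Fk.
      exists k => //; have [_ [kl _]] := Pn _ _ Fk ky.
      by apply: kl => //; exact: hk.
    exists h => //; have [_ [hl _]] := Pn _ _ Fh hx.
    by apply: hl => //; exact: kh.
  by have [_ [_]] := Pn _ _ Fh hx; apply.
- have [g_0|[g0g dg]] := Pg.
    exfalso; apply: (gmax g0); last by right; split.
    by rewrite g_0; split=> // /(_ _ g00).
  have gtot v : exists r, g (v, r).
    have [g' [dg' gg' [r g'v]]] := dominated_graph_extend v dg (g0g _ g00).
    exists r; apply: contrapT => ngv; apply: (gmax g').
      by split=> // g'g; apply: ngv; exact: g'g.
    by right; split=> //; exact: (subset_trans g0g).
  have [f fP] := choice gtot; exists f.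
  have fl a x y : f (a *: x + y) = a * f x + f y.
    by apply: (dominated_graph_fun dg (fP _)); apply: (proj1 dg).
  have fle x : f x <= p x by apply: (proj2 dg).
  split=> // [x r /g0g gx|x]; first exact: (dominated_graph_fun dg (fP _)).
  rewrite ler_norml fle andbT.
  have := fle (- x); have -> : - x = (-1) *: x + 0 by rewrite scaleN1r addr0.
  rewrite fl addr0 p_scale normrN1 mul1r.
  have -> : f 0 = 0.
    by have := fl 1 0 0; rewrite scale1r addr0 mul1r; lra.
  lra.
Qed.

End HahnBanach.

(** * Equivalent norms; bounded, norming and separating functionals *)

Section EquivalentNorm.
Context {R : realType} {X : normedModType R}.
Variable N : X -> R.
Hypothesis HN : equiv_norm N.

Lemma equiv_normD x y : N (x + y) <= N x + N y. Proof. exact: (proj1 HN). Qed.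
Lemma equiv_normZ a x : N (a *: x) = `|a| * N x.
Proof. exact: (proj1 (proj2 HN)). Qed.
Lemma equiv_norm0 : N 0 = 0.
Proof. by rewrite -(scale0r 0) equiv_normZ normr0 mul0r. Qed.
Lemma equiv_normN x : N (- x) = N x.
Proof. by rewrite -scaleN1r equiv_normZ normrN1 mul1r. Qed.
Lemma equiv_norm_ge0 x : 0 <= N x.
Proof. by have := equiv_normD x (- x); rewrite subrr equiv_norm0 equiv_normN; lra. Qed.
Lemma equiv_normB x y : N (x - y) <= N x + N y.
Proof. by rewrite -(equiv_normN y) equiv_normD. Qed.
Lemma equiv_norm_distC x y : N (x - y) = N (y - x).
Proof. by rewrite -equiv_normN opprB. Qed.

Lemma equiv_norm_lb : exists2 c, 0 < c & forall x, c * `|x| <= N x.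
Proof. by have [_ [_ [c [? [? [? h]]]]]] := HN; exists c => // x; have [] := h x. Qed.
Lemma equiv_norm_ub : exists2 c, 0 < c & forall x, N x <= c * `|x|.
Proof. by have [_ [_ [? [c [? [? h]]]]]] := HN; exists c => // x; have [] := h x. Qed.

Lemma equiv_norm_dense (D : set X) (Z : set X) :
  (forall z e, Z z -> 0 < e -> exists d, D d /\ `|z - d| < e) ->
  forall z e, Z z -> 0 < e -> exists d, D d /\ N (z - d) < e.
Proof.
move=> h z e Zz e0; have [c c0 Nc] := equiv_norm_ub.
have [d [Dd zd]] := h z (e / c) Zz (divr_gt0 e0 c0).
exists d; split=> //; apply: le_lt_trans (Nc _) _.
by rewrite mulrC -ltr_pdivlMr.
Qed.

Lemma closed_equiv_normP (Z : set X) : closed Z ->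
  forall x, (forall e, 0 < e -> exists z, Z z /\ N (x - z) < e) -> Z x.
Proof.
move=> Zc x h; apply: Zc => B /nbhs_ballP[e /= e0 eB].
have [c c0 Nc] := equiv_norm_lb.
have [z [Zz xz]] := h (c * e) (mulr_gt0 c0 e0).
exists z; split=> //; apply: eB; rewrite -ball_normE/=.
by rewrite -(ltr_pM2l c0); apply: le_lt_trans xz.
Qed.

Lemma equiv_norm_closed (Z : set X) :
  (forall x, (forall e, 0 < e -> exists z, Z z /\ N (x - z) < e) -> Z x) ->
  closed Z.
Proof.
move=> h x xZ; apply: h => e e0; have [c c0 Nc] := equiv_norm_ub.
have [] := xZ (ball x (e / c)).
  by apply: nbhsx_ballx; exact: divr_gt0.
move=> z [Zz]; rewrite -ball_normE/= => xz; exists z; split=> //.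
by apply: le_lt_trans (Nc _) _; rewrite mulrC -ltr_pdivlMr.
Qed.

Definition bounded_by (f : X -> R) (M : R) : Prop :=
  is_linear_fun f /\ forall x, `|f x| <= M * N x.

Lemma is_clf_bounded_by f : is_clf f -> exists M, bounded_by f M.
Proof.
move=> [fl fc]; have [c c0 Nc] := equiv_norm_lb.
have f0 : f 0 = 0.
  by have := fl 1 0 0; rewrite scale1r addr0 mul1r; lra.
have fZ a x : f (a *: x) = a * f x by have := fl a x 0; rewrite f0 !addr0.
have /cvgrPdist_lt/(_ 1 ltr01) := fc 0.
move=> /nbhs_ballP[d /= d0 df].
(* Rescaling [x] to length [d / 2] puts it where [|f| < 1], so [|f x| <= (2 / d) * |x|]; the factor
   [1 / c] passes from the norm of [X] to [N]. *)
exists (2 / (d * c)); split=> // x.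
have [->|x0] := eqVneq x 0; first by rewrite f0 normr0 equiv_norm0 mulr0.
have nx : 0 < `|x| by rewrite normr_gt0.
have t0 : 0 < d / (2 * `|x|) by rewrite divr_gt0// mulr_gt0.
have : `|f 0 - f ((d / (2 * `|x|)) *: x)| < 1.
  apply: df; rewrite -ball_normE/= sub0r normrN normrZ gtr0_norm//.
  have -> : d / (2 * `|x|) * `|x| = d / 2 by field; rewrite gt_eqF.
  lra.
rewrite f0 sub0r normrN fZ normrM gtr0_norm// mulrC -ltr_pdivlMr// div1r invf_div.
move=> /ltW /le_trans; apply.
rewrite [leRHS](_ : _ = (2 / d) * (c^-1 * N x)); last by rewrite invfM; ring.
have -> : 2 * `|x| / d = 2 / d * `|x| by rewrite mulrAC.
by rewrite ler_pM2l ?divr_gt0// ler_pdivlMl.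
Qed.

Lemma bounded_by_is_clf f M : bounded_by f M -> is_clf f.
Proof.
move=> [fl fM]; split=> // x; apply/cvgrPdist_lt => e e0.
have [c c0 Nc] := equiv_norm_ub.
have fB u v : f u - f v = f (u - v).
  have := fl (-1) v u; rewrite scaleN1r addrC => ->; ring.
pose K := `|M| * c + 1.
have K0 : 0 < K by rewrite ltr_wpDl// mulr_ge0// ltW.
apply/nbhs_ballP; exists (e / K) => /=; first exact: divr_gt0.
move=> y; rewrite -ball_normE/= fB => h.
apply: le_lt_trans (fM _) _; move: h; rewrite ltr_pdivlMr// => h; apply: le_lt_trans h.
have h1 : M * N (x - y) <= `|M| * (c * `|x - y|).
  apply: le_trans (ler_wpM2l (normr_ge0 M) (Nc _)).
  by apply: ler_wpM2r (ler_norm _); exact: equiv_norm_ge0.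
apply: le_trans h1 _; rewrite /K; have := normr_ge0 (x - y); lra.
Qed.

Lemma bounded_by_norming x : exists f, bounded_by f 1 /\ f x = N x.
Proof.
pose g0 : set (X * R) := [set z | exists t, z = (t *: x, t * N x)].
have [||f [fl fg fN]] := @hahn_banach R X N equiv_normD equiv_normZ g0.
- split=> [a u r v s [t [-> ->]] [t' [-> ->]]|u r [t [-> ->]]].
    by exists (a * t + t'); rewrite scalerDl scalerA; congr pair; ring.
  by rewrite equiv_normZ; apply: ler_wpM2r (ler_norm _); exact: equiv_norm_ge0.
- by exists 0; rewrite scale0r mul0r.
exists f; split; first by split=> // y; rewrite mul1r.
by apply: fg; exists 1; rewrite scale1r mul1r.
Qed.

(** The functional [t *: x + z |-> t * d], with [d] a positive lower bound for the distance from [x]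
    to [Z], is dominated by [N]; Hahn-Banach extends it. *)
Lemma closed_subspace_separation (Z : set X) x :
  closed_subspace Z -> ~ Z x ->
  exists f, [/\ exists M, bounded_by f M, forall z, Z z -> f z = 0 & f x != 0].
Proof.
move=> [Z0 [Zl Zc]] nZx.
have [d d0 dx] : exists2 d, 0 < d & forall z, Z z -> d <= N (x - z).
  apply: contrapT => h; apply: nZx; apply: (closed_equiv_normP Zc) => e e0.
  apply: contrapT => h'; apply: h; exists e => // z Zz.
  by rewrite leNgt; apply/negP => xz; apply: h'; exists z.
pose g0 : set (X * R) := [set w | exists t z, Z z /\ w = (t *: x + z, t * d)].
have [||f [fl fg fN]] := @hahn_banach R X N equiv_normD equiv_normZ g0.
- split=> [a u r v s [t [z [Zz [-> ->]]]] [t' [z' [Zz' [-> ->]]]]|u r [t [z [Zz [-> ->]]]]].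
    exists (a * t + t'), (a *: z + z'); split; first exact: Zl.
    by rewrite scalerDl scalerDr scalerA addrACA; congr pair; ring.
  have [->|t0] := eqVneq t 0.
    by rewrite mul0r equiv_norm_ge0.
  have -> : t *: x + z = t *: (x - (- t^-1 *: z + 0)).
    by rewrite addr0 scaleNr opprK scalerDr scalerA divff// scale1r.
  rewrite equiv_normZ; apply: le_trans (ler_norm _) _.
  rewrite normrM (gtr0_norm d0) ler_wpM2l//; apply: dx; exact: Zl.
- by exists 0, 0; rewrite scale0r mul0r addr0.
exists f; split.
- by exists 1; split=> // y; rewrite mul1r.
- by move=> z Zz; apply: fg; exists 0, z; rewrite scale0r mul0r add0r.
- rewrite (fg _ d) ?gt_eqF//; exists 1, 0; split=> //.
  by rewrite scale1r mul1r addr0.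
Qed.

End EquivalentNorm.

(** * Dual norms and weak* compactness *)

Section LimSup.
Context {R : realType}.
Implicit Types (u : (\bar R)^nat) (t : \bar R).

Lemma limn_esup_le_near u t n0 :
  (forall n, (n0 <= n)%N -> (u n <= t)%E) -> (limn_esup u <= t)%E.
Proof.
move=> h; apply: (@le_trans _ _ (ereal_sup (u @` [set n | (n0 <= n)%N]))).
  by apply: ereal_inf_lbound; exists [set n | (n0 <= n)%N] => //; exists n0.
by apply: ge_ereal_sup => _ [n /= n0n <-]; exact: h.
Qed.

Lemma limn_esup_lt_near u t :
  (limn_esup u < t)%E -> exists n0, forall n, (n0 <= n)%N -> (u n < t)%E.
Proof.
move=> h; have [_ [A [n0 _ n0A] <-] At] := ereal_inf_lt h.
exists n0 => n n0n; apply: le_lt_trans At.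
by apply: ereal_sup_ubound; exists n => //; exact: n0A.
Qed.

End LimSup.

Section DualNorm.
Context {R : realType} {X : normedModType R}.
Variables (N : X -> R) (Z : set X).
Hypotheses (HN : equiv_norm N) (Z0 : Z 0)
  (Zl : forall (a : R) x y, Z x -> Z y -> Z (a *: x + y)).
Implicit Types f g : X -> R.

(** [fine] sends infinite values to 0, so this is the dual norm only for members of the dual; see
    [dual_normE]. *)
Definition dualn f : R := fine (dual_norm N Z f).

Lemma in_dual0 f : in_dual N Z f -> f 0 = 0.
Proof.
by move=> [fl _]; have := fl 1 _ _ Z0 Z0; rewrite scale1r addr0 mul1r; lra.
Qed.

Lemma in_dualZ f a z : in_dual N Z f -> Z z -> f (a *: z) = a * f z.
Proof.
by move=> fd Zz; have := (proj1 fd) a _ _ Zz Z0; rewrite (in_dual0 fd) !addr0.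
Qed.

Lemma in_dualB f x y : in_dual N Z f -> Z x -> Z y -> f (x - y) = f x - f y.
Proof.
move=> fd Zx Zy; have := (proj1 fd) (-1) _ _ Zy Zx.
by rewrite scaleN1r addrC => ->; ring.
Qed.

Lemma dual_norm_ge0 f : (0 <= dual_norm N Z f)%E.
Proof.
apply: (@le_trans _ _ (`|f 0|%:E)); first by rewrite lee_fin.
by apply: ereal_sup_ubound; exists 0 => //; split=> //; rewrite equiv_norm0.
Qed.

Lemma dual_normE f : in_dual N Z f -> dual_norm N Z f = (dualn f)%:E.
Proof.
move=> [fl [M fM]]; rewrite /dualn fineK// ge0_fin_numE ?dual_norm_ge0//.
apply: (@le_lt_trans _ _ (`|M|)%:E); last by rewrite ltry.
apply: ge_ereal_sup => _ [z [Zz z1] <-]; rewrite lee_fin.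
apply: le_trans (fM _ Zz) _; apply: le_trans (ler_wpM2r _ (ler_norm M)) _.
  exact: equiv_norm_ge0.
by rewrite ler_piMr.
Qed.

Lemma dualn_ge0 f : 0 <= dualn f.
Proof. by rewrite fine_ge0// dual_norm_ge0. Qed.

Lemma dualn_le f M : 0 <= M -> (forall z, Z z -> `|f z| <= M * N z) ->
  dualn f <= M.
Proof.
move=> M0 fM.
have h : (dual_norm N Z f <= M%:E)%E.
  apply: ge_ereal_sup => _ [z [Zz z1] <-]; rewrite lee_fin.
  by apply: le_trans (fM _ Zz) _; rewrite ler_piMr.
have h2 : dual_norm N Z f \is a fin_num.
  by rewrite ge0_fin_numE ?dual_norm_ge0// (le_lt_trans h)// ltry.
by rewrite -lee_fin /dualn fineK.
Qed.

Lemma dualn_ub f z : in_dual N Z f -> Z z -> `|f z| <= dualn f * N z.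
Proof.
move=> fd Zz; have [Nz|Nz] := eqVneq (N z) 0.
  have [_ [M fM]] := fd; have := fM _ Zz; rewrite Nz !mulr0.
  by [].
have Nz0 : 0 < N z by rewrite lt_neqAle eq_sym Nz equiv_norm_ge0.
rewrite -ler_pdivrMr// mulrC.
have -> : (N z)^-1 * `|f z| = `|f ((N z)^-1 *: z)|.
  by rewrite (in_dualZ _ fd Zz) normrM (gtr0_norm (x := _^-1)) ?invr_gt0.
rewrite -lee_fin -(dual_normE fd); apply: ereal_sup_ubound.
exists ((N z)^-1 *: z) => //; split.
  by have := Zl (N z)^-1 Zz Z0; rewrite addr0.
by rewrite (equiv_normZ HN) gtr0_norm ?invr_gt0// mulVf.
Qed.

Lemma dualn_gt f b : in_dual N Z f -> b < dualn f ->
  exists z, [/\ Z z, N z <= 1 & b < f z].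
Proof.
move=> fd; rewrite -lte_fin -(dual_normE fd) => /ereal_sup_gt[_ [z [Zz z1] <-]].
rewrite lte_fin => bf; have [f0|f0] := leP 0 (f z).
  by exists z; split=> //; rewrite -(ger0_norm f0).
exists (-1 *: z); split.
- by have := Zl (-1) Zz Z0; rewrite addr0.
- by rewrite scaleN1r equiv_normN.
- by rewrite (in_dualZ _ fd Zz) mulN1r -ltr0_norm.
Qed.

Lemma in_dualD f g : in_dual N Z f -> in_dual N Z g ->
  in_dual N Z (fun x => f x + g x).
Proof.
move=> [fl [M fM]] [gl [L gL]]; split=> [a x y Zx Zy|].
  by rewrite fl// gl//; ring.
exists (M + L) => z Zz; rewrite mulrDl (le_trans (ler_normD _ _))// lerD//.
- exact: fM.
- exact: gL.
Qed.

Lemma in_dualBf f g : in_dual N Z f -> in_dual N Z g ->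
  in_dual N Z (fun x => f x - g x).
Proof.
move=> [fl [M fM]] [gl [L gL]]; split=> [a x y Zx Zy|].
  by rewrite fl// gl//; ring.
exists (M + L) => z Zz; rewrite mulrDl (le_trans (ler_normB _ _))// lerD//.
- exact: fM.
- exact: gL.
Qed.

Lemma dualnBf f g : in_dual N Z f -> in_dual N Z g ->
  dualn (fun x => f x - g x) <= dualn f + dualn g.
Proof.
move=> fd gd; apply: dualn_le => [|z Zz]; first by rewrite addr_ge0// dualn_ge0.
by rewrite mulrDl (le_trans (ler_normB _ _))// lerD// dualn_ub.
Qed.

Definition dual_ball (r : R) f : Prop :=
  (forall (a : R) x y, Z x -> Z y -> f (a *: x + y) = a * f x + f y) /\
  forall z, Z z -> `|f z| <= r * N z.

Lemma dual_ball_in_dual r f : dual_ball r f -> in_dual N Z f.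
Proof. by move=> [fl fr]; split=> //; exists r. Qed.

Lemma dual_ball_dualn r f : 0 <= r -> dual_ball r f -> dualn f <= r.
Proof. by move=> r0 [_ fr]; exact: dualn_le. Qed.

Lemma dualn_dual_ball r f : in_dual N Z f -> dualn f <= r -> dual_ball r f.
Proof.
move=> fd fr; split=> [|z Zz]; first exact: (proj1 fd).
by apply: le_trans (dualn_ub fd Zz) (ler_wpM2r (equiv_norm_ge0 HN _) fr).
Qed.

End DualNorm.

Section WeakStarCompactness.
Context {R : realType} {X : normedModType R}.
Variables (N : X -> R) (Z : set X).
Hypotheses (HN : equiv_norm N)
  (Zl : forall (a : R) x y, Z x -> Z y -> Z (a *: x + y)).

Lemma nbhs_ptws_coord (f : {ptws X -> R}) x (a d : R) : `|f x - a| < d ->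
  nbhs f [set h : {ptws X -> R} | `|h x - a| < d].
Proof.
move=> fd.
have d0 : 0 < d - `|f x - a| by rewrite subr_gt0.
have nb : nbhs (f x) (ball (f x) (d - `|f x - a|)) by exact: nbhsx_ballx.
have h : nbhs (f : {ptws X -> R}) (fun g : {ptws X -> R} => ball (f x) (d - `|f x - a|) (g x)) := @proj_continuous X (fun=> R) x f _ nb.
have hh : (fun g : {ptws X -> R} => ball (f x) (d - `|f x - a|) (g x)) `<=` [set h : {ptws X -> R} | `|h x - a| < d].
  move=> g; rewrite -ball_normE/= => hx.
  have -> : g x - a = (g x - f x) + (f x - a) by ring.
  by rewrite (le_lt_trans (ler_normD _ _))// -ltrBrDr distrC.
exact: (@filterS _ (nbhs (f : {ptws X -> R})) _ _ _ hh h).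
Qed.

(** Banach-Alaoglu: the ball is a closed part of a product of segments, hence compact by Tychonoff.
    The function [rho] lets the size of each basic neighbourhood depend on its centre, and a finite
    subcover is extracted. *)
Lemma dual_ball_cover (r : R) (z : nat -> X) (rho : (X -> R) -> nat) :
  0 <= r -> (forall i, Z (z i)) ->
  exists2 es : seq (X -> R), (forall e, e \in es -> dual_ball N Z r e) &
    forall f, dual_ball N Z r f -> exists2 e, e \in es &
      forall i, (i <= rho e)%N -> `|f (z i) - e (z i)| < (rho e).+1%:R^-1.
Proof.
move=> r0 Zz.
(* Values off [Z] are bounded as well, so that the product runs over all of [X]. *)
pose P : set {ptws X -> R} := [set f | forall x, `[- (r * N x), r * N x]%classic (f x)].
have cP : compact P.
  by apply: (@tychonoff X (fun=> R) (fun x => `[- (r * N x), r * N x]%classic)) => x;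
     exact: segment_compact.
pose B : set {ptws X -> R} := P `&` [set f | dual_ball N Z r f].
have cB : compact B.
  apply: (subclosed_compact _ cP); last by move=> f [].
  move=> f fB; have fn x : `|f x| <= r * N x.
    apply/ler_addgt0Pr => e e0.
    have [|h [[hP _] /= hx]] := fB [set h | `|h x - f x| < e].
      by apply: nbhs_ptws_coord; rewrite subrr normr0.
    move: (hP x); rewrite /= in_itv/= -ler_norml => hr.
    have -> : f x = h x - (h x - f x) by ring.
    by rewrite (le_trans (ler_normB _ _))// lerD// ltW.
  split; first by move=> x; rewrite /= in_itv/= -ler_norml.
  split=> [a x y Zx Zy|x _]; last exact: fn.
  apply/eqP; rewrite -subr_eq0 -normr_le0; apply/ler_addgt0Pr => e e0.
  (* The failure of linearity of [f] is controlled by three coordinates of a nearby [h]; the errors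
     [d], [|a| * d] and [d] add up to [e]. *)
  pose d := e / (2 + `|a|).
  have d0 : 0 < d by rewrite divr_gt0// ltr_wpDr.
  have [|h [[_ [hl _]] /= [[h1 h2] h3]]] := fB
      ([set h | `|h (a *: x + y) - f (a *: x + y)| < d] `&`
       [set h | `|h x - f x| < d] `&` [set h | `|h y - f y| < d]).
    by apply: (@filterI _ (nbhs (f : {ptws X -> R})));
      [apply: (@filterI _ (nbhs (f : {ptws X -> R})))|];
      apply: nbhs_ptws_coord; rewrite subrr normr0.
  have -> : f (a *: x + y) - (a * f x + f y) =
    (h y - f y) + a * (h x - f x) - (h (a *: x + y) - f (a *: x + y)).
    by rewrite hl//; ring.
  rewrite add0r (_ : e = d + `|a| * d + d); last first.
    by rewrite /d; field; rewrite gt_eqF// ltr_wpDr.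
  apply: le_trans (ler_normB _ _) _; apply: lerD; last exact: ltW.
  apply: le_trans (ler_normD _ _) _; apply: lerD; first exact: ltW.
  by rewrite normrM ler_wpM2l// ltW.
pose V (e : X -> R) : set {ptws X -> R} :=
  [set f | forall i, (i <= rho e)%N -> `|f (z i) - e (z i)| < (rho e).+1%:R^-1].
pose ptR : ptopologicalType := HB.pack_for ptopologicalType {ptws X -> R}
  (isPointed.Build {ptws X -> R} (fun=> 0)).
have ccB := cB; rewrite (@compact_cover ptR) in ccB.
have [||D DB Dcov] := ccB (X -> R : choiceType) (B : set (X -> R)) V.
- move=> e _; rewrite openE => f Vf; rewrite /interior.
  suff h n : (n <= rho e)%N -> nbhs f [set g : {ptws X -> R} | forall i, (i <= n)%N ->
      `|g (z i) - e (z i)| < (rho e).+1%:R^-1] by exact: h.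
  elim: n => [|n IH] nr.
    apply: (@filterS _ (nbhs (f : {ptws X -> R})) _ _ _ _
      (nbhs_ptws_coord (Vf 0%N (leq0n _)))).
    by move=> g /= g0 i; rewrite leqn0 => /eqP ->.
  apply: (@filterS _ (nbhs (f : {ptws X -> R})) _ _ _ _
    (@filterI _ (nbhs (f : {ptws X -> R})) _ _ _ (IH (ltnW nr))
      (nbhs_ptws_coord (Vf _ nr)))).
  move=> g [/= gn gS] i; rewrite leq_eqVlt => /predU1P[->//|].
  by rewrite ltnS; exact: gn.
- by move=> f Bf; exists f => //= i _; rewrite subrr normr0 invr_gt0.
- exists (finmap.enum_fset D) => [e /DB /set_mem[_]//|f [fl fr]].
  (* Members of [dual_ball] are arbitrary off [Z]; setting them to 0 there brings them into [P]. *)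
  pose f' x := if `[< Z x >] then f x else 0.
  have f'E x : Z x -> f' x = f x by move=> Zx; rewrite /f' asboolT.
  have Bf' : B f'.
    split=> [x|].
      rewrite /= in_itv/= -ler_norml /f'; case: asboolP => [/fr//|_].
      by rewrite normr0 mulr_ge0// equiv_norm_ge0.
    split=> [a x y Zx Zy|x Zx]; last by rewrite f'E// fr.
    by rewrite !f'E//; [exact: fl|exact: Zl].
  have [e eD /= ef] := Dcov _ Bf'; exists e => // i ir.
  by rewrite -(f'E _ (Zz i)); exact: ef.
Qed.

End WeakStarCompactness.

(** * Separable spaces with a Lipschitz weak* Kadec-Klee norm *)

Lemma countable_enumeration (T : Type) (D : set T) : countable D -> D !=set0 ->
  exists z : nat -> T, (forall n, D (z n)) /\ forall d, D d -> exists n, z n = d.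
Proof.
move=> /countable_injP[f fi] [d0 Dd0].
have /choice[z zP] : forall n, exists d, D d /\
    forall d', D d' -> f d' = n -> d = d'.
  move=> n; have [[d [Dd fd]]|h] := pselect (exists d, D d /\ f d = n); last first.
    by exists d0; split=> // d' Dd' fd'; exfalso; apply: h; exists d'.
  exists d; split=> // d' Dd' fd'; apply: fi; rewrite ?inE//.
  by rewrite fd fd'.
exists z; split=> [n|d Dd]; first by have [] := zP n.
by exists (f d); have [_] := zP (f d); apply.
Qed.

Lemma near_infty_invS (R : realType) (e : R) : 0 < e ->
  exists K, forall n, (K <= n)%N -> n.+1%:R^-1 < e.
Proof.
move=> e0; exists (Num.trunc e^-1) => n Kn.
rewrite invf_plt ?posrE//; apply: (lt_le_trans (truncnS_gt _)).
by rewrite ler_nat ltnS.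
Qed.

Section LKKSeparable.
Context {R : realType} {X : normedModType R}.
Variables (N : X -> R) (Z : set X) (c : R) (z : nat -> X).
Hypotheses (HN : equiv_norm N) (HZ : closed_subspace Z) (sZ : separable_set Z)
  (c0 : 0 < c) (c1 : c <= 1) (HK : LwsKK N c)
  (Zz : forall i, Z (z i))
  (zd : forall x (e : R), Z x -> 0 < e -> exists i, N (x - z i) < e).
Implicit Types e f g : X -> R.

Let Z0 : Z 0 := proj1 HZ.
Let Zl : forall (a : R) x y, Z x -> Z y -> Z (a *: x + y) := proj1 (proj2 HZ).
Local Notation dn := (dualn N Z).
Local Notation dual := (in_dual N Z).
Local Notation ball := (dual_ball N Z).

Let ZB x y : Z x -> Z y -> Z (x - y).
Proof. by move=> Zx Zy; have := Zl (-1) Zy Zx; rewrite scaleN1r addrC. Qed.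

(** The hypothesis makes the sequence null at each [z i]; boundedness carries this over to the
    points that the [z i] approximate. *)
Lemma dual_null_of_dense (r : R) (g : nat -> X -> R) :
  (forall n, dual (g n)) -> (forall n, dn (g n) <= r) ->
  (forall n i, (i <= n)%N -> `|g n (z i)| <= 2 * n.+1%:R^-1) ->
  forall x (d : R), Z x -> 0 < d -> exists K, forall n, (K <= n)%N -> `|g n x| < d.
Proof.
move=> gd gr gz x d Zx d0.
have r0 : 0 <= r by apply: le_trans (dualn_ge0 HN Z0 _) (gr 0%N).
have [i zi] : exists i, N (x - z i) < d / (2 * (r + 1)).
  by apply: zd => //; rewrite divr_gt0// mulr_gt0// ltr_wpDl.
have d4 : 0 < d / 4 by rewrite divr_gt0.
have [K KP] := near_infty_invS d4.
exists (maxn i K) => n; rewrite geq_max => /andP[ni nK].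
have -> : g n x = g n (x - z i) + g n (z i) by rewrite (in_dualB (gd n))//; ring.
apply: le_lt_trans (ler_normD _ _) _.
have h1 : `|g n (x - z i)| <= (r + 1) * N (x - z i).
  apply: le_trans (dualn_ub HN Z0 Zl (gd n) _) _; first exact: ZB.
  by apply: ler_wpM2r; [exact: equiv_norm_ge0|rewrite (le_trans (gr n))// lerDl].
have h2 : (r + 1) * N (x - z i) < d / 2.
  rewrite mulrC -ltr_pdivlMr ?ltr_wpDl//.
  by rewrite -mulrA -invfM.
move: (KP _ nK) (gz _ _ ni); set t : R := n.+1%:R^-1 => ? ?.
by move: h1 h2; set u := `|g n (x - z i)|; set v := (r + 1) * _; lra.
Qed.

(** Counterexamples [g n] for every [n] would form a bounded weak*-null sequence that violates the
    Kadec-Klee inequality at [e]. *)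
Lemma LwsKK_uniform (r d : R) e : 0 < d -> dual e ->
  exists n, forall g, dual g -> dn g <= r ->
    (forall i, (i <= n)%N -> `|g (z i)| <= 2 * n.+1%:R^-1) ->
    dn e + c * dn g - d <= dn (fun x => e x + g x).
Proof.
move=> d0 ed; apply: contrapT => h.
have /choice[g gP] : forall n, exists g, [/\ dual g, dn g <= r,
   (forall i, (i <= n)%N -> `|g (z i)| <= 2 * n.+1%:R^-1) &
    dn (fun x => e x + g x) < dn e + c * dn g - d].
  move=> n; apply: contrapT => h'; apply: h; exists n => g gd gr gz.
  by rewrite leNgt; apply/negP => gl; apply: h'; exists g.
have gd n : dual (g n) by have [] := gP n.
have := HK HZ sZ ed gd.
have gnull x : Z x -> (fun n => g n x) @ \oo --> (0 : R).
  move=> Zx; apply/cvgrPdist_lt => t t0.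
  have gr n : dn (g n) <= r by have [] := gP n.
  have gz n : forall i, (i <= n)%N -> `|g n (z i)| <= 2 * n.+1%:R^-1.
    by have [] := gP n.
  have [K KP] := dual_null_of_dense gd gr gz Zx t0.
  by exists K => // n /= Kn; rewrite sub0r normrN; exact: KP.
move=> /(_ gnull).
set L := limn_esup _.
have L0 : (0 <= L)%E.
  rewrite leNgt; apply/negP => /limn_esup_lt_near[n0 /(_ n0 (leqnn _))].
  by rewrite ltNge (dual_norm_ge0 HN Z0).
have Lr : (L <= r%:E)%E.
  apply: (@limn_esup_le_near _ _ _ 0) => n _.
  by rewrite (dual_normE HN Z0)// lee_fin; have [] := gP n.
have Lf : L \is a fin_num by rewrite ge0_fin_numE// (le_lt_trans Lr)// ltry.
rewrite (dual_normE HN Z0 ed) -(fineK Lf) -EFinM -EFinD => hh.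
(* An excess of [d / (2 * c)] over the upper limit costs [d / 2] after multiplication by [c], which
   leaves a gap of [d / 2] for the contradiction. *)
have [n0 n0P] : exists n0, forall n, (n0 <= n)%N -> dn (g n) < fine L + d / (2 * c).
  have [|n0 n0P] := @limn_esup_lt_near _ (fun n => dual_norm N Z (g n)) (fine L + d / (2 * c))%:E.
    rewrite -/L -[L in (L < _)%E](fineK Lf) lte_fin ltrDl divr_gt0// mulr_gt0//.
  by exists n0 => n /n0P; rewrite (dual_normE HN Z0)// lte_fin.
have : (limn_esup (fun n => dual_norm N Z (fun x => (e x + g n x)%R))
   <= (dn e + c * (fine L + d / (2 * c)) - d)%:E)%E.
  apply: (@limn_esup_le_near _ _ _ n0) => n /n0P gn.
  rewrite (dual_normE HN Z0)//; last exact: in_dualD.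
  rewrite lee_fin; have [_ _ _ /ltW/le_trans] := gP n; apply.
  by rewrite lerD2r lerD2l ler_pM2l// ltW.
move=> /(le_trans hh); rewrite lee_fin mulrDr.
have -> : c * (d / (2 * c)) = d / 2 by field; rewrite gt_eqF.
lra.
Qed.

End LKKSeparable.

Section GeometricWeights.
Context {R : realType}.

(** The weights start at 1/8, so that the total error is 1/4: this is the source of the constants
    5/4 and [N x / 4] below. *)
Definition geo (j : nat) : R := 2^-1 ^+ j.+3.

Lemma geo_gt0 j : 0 < geo j. Proof. by rewrite exprn_gt0// invr_gt0. Qed.

Lemma sum_geo J : \sum_(j < J) geo j = 1 / 4 - 2 * geo J.
Proof.
elim: J => [|J IH]; first by rewrite big_ord0 /geo; field.
by rewrite big_ord_recr/= IH /geo (exprS _ J.+3); field.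
Qed.

End GeometricWeights.

(** * Expansion of functionals over finite sets *)

Section SeparableDecomposition.
Context {R : realType} {X : normedModType R}.
Variables (N : X -> R) (Z : set X) (c : R) (z : nat -> X).
Hypotheses (HN : equiv_norm N) (HZ : closed_subspace Z) (sZ : separable_set Z)
  (c0 : 0 < c) (c1 : c <= 1) (HK : LwsKK N c)
  (Zz : forall i, Z (z i))
  (zd : forall x (e : R), Z x -> 0 < e -> exists i, N (x - z i) < e).
Implicit Types e f g s : X -> R.

Let Z0 : Z 0 := proj1 HZ.
Let Zl : forall (a : R) x y, Z x -> Z y -> Z (a *: x + y) := proj1 (proj2 HZ).
Local Notation dn := (dualn N Z).
Local Notation dual := (in_dual N Z).
Local Notation ball := (dual_ball N Z).
Local Notation addf s e := (fun x => s x + e x).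
Local Notation subf s e := (fun x => s x - e x).
Local Notation r0 := (2 / c).

(** Choice functions for the construction: [nn] gives the size of a neighbourhood on which the
    Kadec-Klee inequality holds, [tt] a size that forces small values, [cov] a finite cover of the
    ball. The bound [2 * r0] is that of a difference of two members of the ball of radius [r0]. *)
Lemma decomposition_data : exists
  (nn : (X -> R) -> R -> nat) (tt : nat -> nat)
  (cov : ((X -> R) -> nat) -> seq (X -> R)),
  [/\ forall e d, dual e -> 0 < d -> forall g, dual g -> dn g <= 2 * r0 ->
        (forall i, (i <= nn e d)%N -> `|g (z i)| <= 2 * (nn e d).+1%:R^-1) ->
        dn e + c * dn g - d <= dn (addf e g),
      forall j, (j <= tt j)%N /\ 2 * (tt j).+1%:R^-1 <= geo j.+1 / j.+1%:R :> R,
      forall rho e, e \in cov rho -> ball r0 e &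
      forall rho f, ball r0 f -> exists2 e, e \in cov rho &
        forall i, (i <= rho e)%N -> `|f (z i) - e (z i)| < (rho e).+1%:R^-1].
Proof.
have r00 : 0 <= r0 by rewrite divr_ge0// ltW.
have /choice[nn nnP] : forall ed : (X -> R) * R, exists n, dual ed.1 -> 0 < ed.2 ->
    forall g, dual g -> dn g <= 2 * r0 ->
    (forall i, (i <= n)%N -> `|g (z i)| <= 2 * n.+1%:R^-1) ->
    dn ed.1 + c * dn g - ed.2 <= dn (addf ed.1 g).
  move=> [e d] /=; have [[ed d0]|h] := pselect (dual e /\ 0 < d); last first.
    by exists 0%N => ed d0; exfalso; apply: h.
  have [n nP] := LwsKK_uniform HN HZ sZ c0 HK Zz zd (2 * r0) d0 ed.
  by exists n.
have /choice[tt ttP] : forall j, exists t, (j <= t)%N /\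
    2 * t.+1%:R^-1 <= geo j.+1 / j.+1%:R :> R.
  move=> j; have [|K KP] := @near_infty_invS R (geo j.+1 / j.+1%:R / 2).
    by rewrite !divr_gt0// geo_gt0.
  exists (maxn j K); split; first exact: leq_maxl.
  move: (KP _ (leq_maxr j K)).
  by set t : R := (maxn j K).+1%:R^-1; set u : R := geo j.+1 / j.+1%:R; lra.
have /choice[cov covP] : forall rho : (X -> R) -> nat, exists es : seq (X -> R),
    (forall e, e \in es -> ball r0 e) /\
    forall f, ball r0 f -> exists2 e, e \in es &
      forall i, (i <= rho e)%N -> `|f (z i) - e (z i)| < (rho e).+1%:R^-1.
  move=> rho; have [es h1 h2] := dual_ball_cover HN Zl rho r00 Zz.
  by exists es.
exists (fun e d => nn (e, d)), tt, cov; split=> //.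
- by move=> e d ed d0; exact: (nnP (e, d)).
- by move=> rho; have [] := covP rho.
- by move=> rho; have [] := covP rho.
Qed.

(** Greedy expansion: [e j] is a centre near the remainder [g j], and [g j.+1 = g j - e j]. The
    Kadec-Klee inequality at the partial sum [s j.+1] is used twice: with increment [g j.+1], where
    the sum is [f], it keeps the remainder in the ball; with increment [e j.+1] it telescopes to the
    bound on the sum of the norms. *)
Lemma separable_decomposition : exists E : nat -> seq (X -> R),
  (forall j e, e \in E j -> dual e) /\
  forall f, ball 1 f -> exists e g : nat -> X -> R,
   [/\ forall j, e j \in E j,
       forall j i, (i < j)%N -> `|e j (z i)| <= geo j / j%:R,
       forall J, c * (\sum_(j < J.+1) dn (e j)) <= 5 / 4,
       forall J x, f x = \sum_(j < J) e j x + g J x &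
       forall x (d : R), Z x -> 0 < d -> exists K, forall n, (K <= n)%N -> `|g n.+1 x| < d].
Proof.
have r00 : 0 <= r0 by rewrite divr_ge0// ltW.
have [nn [tt [cov [nnP ttP covB covP]]]] := decomposition_data.
(* The precision required around [e] at stage [j] beats the earlier precisions [m], the index
   [tt j], and the Kadec-Klee index of [s + e] for every possible partial sum [s]. Hence the finite
   sets do not depend on [f]. *)
pose rho (Sg : seq (X -> R)) m j e :=
  maxn m (maxn (tt j) (\max_(s <- Sg) nn (addf s e) (geo j))).
(* The state before stage [j]: all partial sums that can occur, and the largest precision used at
   the preceding stage. *)
pose st := fix st j : seq (X -> R) * nat := if j is j'.+1 then
   let r := rho (st j').1 (st j').2 j' in
   ([seq addf s e | s <- (st j').1, e <- cov r], \max_(e <- cov r) r e)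
  else ([:: fun=> 0], 0%N).
pose rj j := rho (st j).1 (st j).2 j.
pose E j := cov (rj j).
have rj_tt j e : (tt j <= rj j e)%N.
  by rewrite /rj /rho !leq_max leqnn orbT.
have rj_nn j s e : s \in (st j).1 -> (nn (addf s e) (geo j) <= rj j e)%N.
  move=> sS; rewrite /rj /rho !leq_max; apply/orP; right; apply/orP; right.
  exact: (@leq_bigmax_seq _ _ predT (fun s => nn (addf s e) (geo j))).
have rjS j e e' : e \in E j -> (rj j e <= rj j.+1 e')%N.
  move=> eE; rewrite [in leqRHS]/rj /rho leq_max; apply/orP; left => /=.
  exact: (@leq_bigmax_seq _ _ predT (rj j)).
have Ed j e : e \in E j -> dual e.
  by move=> /covB; exact: dual_ball_in_dual.
have dual0 : dual (fun=> 0).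
  split=> [a x y _ _|]; first by rewrite mulr0 addr0.
  by exists 0 => x _; rewrite normr0 mul0r.
have Sd j s : s \in (st j).1 -> dual s.
  elim: j s => [|j IH] s; first by rewrite inE => /eqP ->.
  move=> /allpairsP[[s' e] /= [/IH s'd eE ->]]; apply: in_dualD => //.
  exact: (Ed j).
exists E; split=> // f fb.
have fd : dual f by exact: dual_ball_in_dual fb.
have f1 : dn f <= 1 by exact: (dual_ball_dualn HN Z0 ler01 fb).
have /choice[pk pkP] : forall jg : nat * (X -> R), exists e, ball r0 jg.2 ->
   e \in E jg.1 /\ forall i, (i <= rj jg.1 e)%N ->
     `|jg.2 (z i) - e (z i)| < (rj jg.1 e).+1%:R^-1.
  move=> [j g] /=; have [gb|h] := pselect (ball r0 g); last by exists (fun=> 0).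
  by have [e eE ee] := covP (rj j) g gb; exists e.
pose g := fix g j := if j is j'.+1 then subf (g j') (pk (j', g j')) else f.
pose e j := pk (j, g j).
have gS k x : g k.+1 x = g k x - e k x by [].
pose s := fix s j := if j is j'.+1 then addf (s j') (e j') else fun=> 0.
have sg j x : s j x + g j x = f x.
  by elim: j => [|j IH]; rewrite /= ?add0r// -IH /e; ring.
have sgE j : addf (s j) (g j) = f by apply/funext => x; exact: sg.
have inv j : ball r0 (g j) /\ s j \in (st j).1 ->
   [/\ e j \in E j, s j.+1 \in (st j.+1).1, dual (g j.+1), dn (g j.+1) <= 2 * r0 &
     forall i, (i <= rj j (e j))%N -> `|g j.+1 (z i)| < (rj j (e j)).+1%:R^-1].
  move=> [gb sS]; have [eE ee] := pkP (j, g j) gb.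
  have ed := Ed _ _ eE; have gd := dual_ball_in_dual gb.
  split=> //; last 2 first.
  - exact: in_dualBf.
  - apply: le_trans (dualnBf HN Z0 Zl gd ed) _.
    have := dual_ball_dualn HN Z0 r00 gb.
    have := dual_ball_dualn HN Z0 r00 (covB _ _ eE); lra.
  - by apply/allpairsP; exists (s j, e j).
have small j m t : (j <= m)%N -> 0 <= t -> t < m.+1%:R^-1 :> R -> t <= j.+1%:R^-1.
  move=> jm t0 tm; apply: le_trans (ltW tm) _.
  by rewrite lef_pV2 ?posrE// ler_nat ltnS.
have keyB j : ball r0 (g j) /\ s j \in (st j).1 ->
   dn (s j.+1) + c * dn (g j.+1) - geo j <= 1.
  move=> h; have [eE sS gd gr gz] := inv _ h; have [gb sS0] := h.
  apply: le_trans f1; rewrite -(sgE j.+1).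
  apply: nnP => //; [exact: Sd sS|exact: geo_gt0|move=> i ii].
  have ir := leq_trans ii (rj_nn _ _ (e j) sS0).
  have := small _ _ _ (rj_nn _ _ (e j) sS0) (normr_ge0 _) (gz i ir).
  have : 0 <= (nn (addf (s j) (e j)) (geo j)).+1%:R^-1 :> R by rewrite invr_ge0.
  by move=> ? /le_trans; apply; rewrite ler_peMl// ler1n.
(* [keyB] gives [c * dn (g j.+1) <= 1 + geo j <= 2]; this is why the radius is [r0 = 2 / c]. *)
have inv2 j : ball r0 (g j) /\ s j \in (st j).1.
  elim: j => [|j IH].
    split; last by rewrite /= inE.
    apply: (dualn_dual_ball HN Z0 Zl fd); apply: le_trans f1 _; by rewrite ler_pdivlMr// mul1r (le_trans c1)// ler1n.
  have [eE sS gd gr gz] := inv _ IH; split=> //.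
  apply: (dualn_dual_ball HN Z0 Zl gd); rewrite ler_pdivlMr// mulrC.
  have := keyB _ IH; have := dualn_ge0 HN Z0 (s j.+1).
  have : geo j <= 1 :> R by rewrite exprn_ile1// ?invr_ge0// invf_le1//; lra.
  lra.
have einv j := inv j (inv2 j).
(* [e j.+1] is the difference of two successive remainders, and both are small at the first points
   [z i]. *)
have ez j i : (i <= rj j (e j))%N ->
   `|e j.+1 (z i)| <= 2 * (rj j (e j)).+1%:R^-1.
  move=> ir; have [eE sS gd gr gz] := einv j; have [eE' sS' gd' gr' gz'] := einv j.+1.
  have rr := rjS _ _ (e j.+1) eE.
  have -> : e j.+1 (z i) = g j.+1 (z i) - g j.+2 (z i).
    by rewrite (gS j.+1); ring.
  apply: le_trans (ler_normB _ _) _.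
  have := small _ _ _ rr (normr_ge0 _) (gz' i (leq_trans ir rr)).
  have := ltW (gz i ir).
  by set t : R := _.+1%:R^-1; set u := `|_|; set v := `|_|; lra.
have ed j : dual (e j) by have [/Ed] := einv j.
have sd j : dual (s j) by have [_ /Sd] := inv2 j.
exists e, g; split=> //.
- by move=> j; have [] := einv j.
- move=> [//|j] i ij; have [jt tj] := ttP j.
  have ir : (i <= rj j (e j))%N.
    by apply: leq_trans (rj_tt _ _); apply: leq_trans jt; rewrite -ltnS.
  apply: le_trans (ez _ _ ir) _; apply: le_trans tj.
  by rewrite ler_pM2l// lef_pV2 ?posrE// ler_nat ltnS.
- move=> J; have key := keyB J (inv2 J).
  have gJ := dualn_ge0 HN Z0 (g J.+1).
  (* Telescoping costs [geo j] per step; together with [dn (s J.+1) <= 1 + geo J] and [sum_geo] this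
     stays below 5/4. *)
  suff h : c * (\sum_(j < J.+1) dn (e j)) <= dn (s J.+1) + \sum_(j < J) geo j.
    have := mulr_ge0 (ltW c0) gJ; have := @sum_geo R J; have := @geo_gt0 R J; lra.
  elim: J {key gJ} => [|J IH].
    rewrite big_ord1 big_ord0 addr0.
    have -> : s 1%N = e 0%N by apply/funext => x; rewrite /= add0r.
    by rewrite ler_piMl// dualn_ge0.
  rewrite big_ord_recr/= mulrDr [in leRHS]big_ord_recr/=.
  have [eE sS gd gr gz] := einv J; have [eE' sS' _ _ _] := einv J.+1.
  have sSJ := proj2 (inv2 J).
  have := nnP (s J.+1) (geo J) (sd _) (geo_gt0 _) (e J.+1) (ed _).
  have := rj_nn _ _ (e J) sSJ; rewrite -/(s J.+1) => rn.
  have e2 : dn (e J.+1) <= 2 * r0.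
    have := dual_ball_dualn HN Z0 r00 (covB _ _ eE'); have := r00; lra.
  move=> /(_ e2) h; have {}h := h _.
  have : dn (s J.+1) + c * dn (e J.+1) - geo J <= dn (s J.+2).
    apply: h => i ii; apply: le_trans (ez _ _ (leq_trans ii rn)) _.
    by rewrite ler_pM2l// lef_pV2 ?posrE// ler_nat ltnS.
  lra.
- move=> J x; rewrite -(sg J); congr (_ + _).
  by elim: J => [|J IH]; rewrite ?big_ord0// big_ord_recr/= IH.
- apply: (@dual_null_of_dense _ _ N Z z HN HZ Zz zd r0 (fun n => g n.+1)).
  + by move=> n; have [] := einv n.
  + by move=> n; apply: (dual_ball_dualn HN Z0 r00); have [] := inv2 n.+1.
  + move=> n i ni; have [_ _ _ _ gz] := einv n; have [nt _] := ttP n.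
    have nr := leq_trans nt (rj_tt n (e n)).
    apply: le_trans (small _ _ _ nr (normr_ge0 _) (gz i (leq_trans ni nr))) _.
    by rewrite ler_peMl ?invr_ge0// ler1n.
Qed.

End SeparableDecomposition.

(** * Embedding of separable subspaces into c_0 *)

Section SeparableEmbedding.
Context {R : realType} {X : normedModType R}.
Variables (N : X -> R) (Z : set X) (c : R).
Hypotheses (HN : equiv_norm N) (HZ : closed_subspace Z) (sZ : separable_set Z)
  (c0 : 0 < c) (c1 : c <= 1) (HK : LwsKK N c).

Lemma separable_set_seq : exists z : nat -> X, (forall i, Z (z i)) /\
  forall x (e : R), Z x -> 0 < e -> exists i, N (x - z i) < e.
Proof.
have [D [Dc [DZ Dd]]] := sZ; have Dd' := equiv_norm_dense HN Dd.
have [d0 [Dd0 _]] := Dd 0 1 (proj1 HZ) ltr01.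
have [z [zD zs]] := countable_enumeration Dc (ex_intro _ d0 Dd0).
exists z; split=> [i|x e Zx e0]; first exact: DZ.
have [d [/zs[i <-] xd]] := Dd' x e Zx e0; by exists i.
Qed.

(** The coordinates are the normalised members of the sets [E j]. To bound [N x], a norming
    functional of [x] is expanded over these sets: large terms are paid for by [S], small ones by
    the geometric weights. *)
Theorem separable_embedding : exists s : nat * nat -> X -> R,
  [/\ forall p, dual_ball N Z 1 (s p),
      forall x, Z x -> in_c0 (fun p => s p x) &
      forall x S, Z x -> (forall p, `|s p x| <= S) -> N x <= 2 / c * S].
Proof.
have Z0 : Z 0 := proj1 HZ.
have Zl : forall (a : R) x y, Z x -> Z y -> Z (a *: x + y) := proj1 (proj2 HZ).
have ZB x y : Z x -> Z y -> Z (x - y).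
  by move=> Zx Zy; have := Zl (-1) _ _ Zy Zx; rewrite scaleN1r addrC.
have [z [Zz zd]] := separable_set_seq.
have [E [Ed EP]] := separable_decomposition HN HZ sZ c0 c1 HK Zz zd.
pose dn := dualn N Z.
(* Only members of norm at least [geo j] are normalised, so their values at [z i], [i < j], are at
   most [1 / j] afterwards; this makes the coordinates weak*-null. *)
pose good j e := `[< geo j <= dn e /\
  forall i, (i < j)%N -> `|e (z i)| <= geo j / j%:R >].
pose Sn j := [seq (fun x => (dn e)^-1 * e x) | e <- E j & good j e].
pose s (p : nat * nat) := nth (fun=> 0) (Sn p.1) p.2.
have sP p : s p = (fun=> 0) \/ exists e, [/\ in_dual N Z e, geo p.1 <= dn e,
    (forall i, (i < p.1)%N -> `|e (z i)| <= geo p.1 / p.1%:R), (p.2 < size (Sn p.1))%N &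
    s p = (fun x => (dn e)^-1 * e x)].
  have [h|h] := leqP (size (Sn p.1)) p.2; first by left; rewrite /s nth_default.
  right; have : s p \in Sn p.1 by rewrite mem_nth.
  move=> /mapP[e]; rewrite mem_filter => /andP[/asboolP[h1 h2] eE] ->.
  by exists e; split=> //; exact: (Ed p.1).
have dn0 p e : geo p <= dn e -> 0 < dn e by apply: lt_le_trans; exact: geo_gt0.
have sb p : dual_ball N Z 1 (s p).
  have [->|[e [ed e0 ez _ ->]]] := sP p.
    split=> [a x y _ _|x _]; first by rewrite mulr0 addr0.
    by rewrite normr0 mul1r equiv_norm_ge0.
  have e0' := dn0 _ _ e0.
  split=> [a x y Zx Zy|x Zx]; first by rewrite (proj1 ed)//; ring.
  rewrite normrM gtr0_norm ?invr_gt0// mul1r ler_pdivrMl//.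
  exact: (dualn_ub HN Z0 Zl ed).
exists s; split=> //.
- move=> x Zx t t0.
  have t2 : 0 < t / 2 by rewrite divr_gt0.
  have [i xi] := zd x _ Zx t2.
  have [K KP] := near_infty_invS t2.
  (* With [z i] within [t / 2] of [x], any index [j] above both [i.+1] and [K] gives coordinates of
     [x] smaller than [t]; finitely many rows remain, each finite. *)
  apply: (@sub_finite_set _ _ (\bigcup_(j in `I_(maxn i.+1 K).+1)
     [set (j, k) | k in `I_(size (Sn j))])).
    move=> [j k] /= tj.
    have [h|[e [ed e0 ez kS h]]] := sP (j, k).
      by move: tj; rewrite h normr0 leNgt t0.
    rewrite /= in e0 ez kS.
    exists j; last by exists k.
    rewrite /= ltnS leqNgt; apply/negP; rewrite gtn_max => /andP[ij Kj].
    have j0 : (0 < j)%N by apply: leq_trans ij.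
    move: tj; apply/negP; rewrite -ltNge.
    have -> : s (j, k) x = s (j, k) (x - z i) + s (j, k) (z i).
      rewrite (in_dualB (dual_ball_in_dual (sb (j, k))))//; ring.
    have h1 := (proj2 (sb (j, k))) _ (ZB _ _ Zx (Zz i)).
    have h2 : `|s (j, k) (z i)| < t / 2.
      have Kj' : (K <= j.-1)%N by rewrite -ltnS prednK.
      apply: le_lt_trans (KP _ Kj'); rewrite prednK// h normrM gtr0_norm; last first.
        by rewrite invr_gt0 (dn0 _ _ e0).
      rewrite ler_pdivrMl ?(dn0 _ _ e0)//; apply: le_trans (ez _ (ltnW ij)) _.
      by rewrite ler_pM2r// invr_gt0 ltr0n.
    apply: le_lt_trans (ler_normD _ _) _; lra.
  apply: bigcup_finite; first exact: finite_II.
  by move=> j _; apply: finite_image; exact: finite_II.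
- move=> x S Zx xS.
  have S0 : 0 <= S by apply: le_trans (xS (0, 0)%N).
  have [f [fb fx]] := bounded_by_norming HN x.
  have fb1 : dual_ball N Z 1 f.
    by split=> [a u v _ _|u _]; [exact: (proj1 fb)|exact: (proj2 fb)].
  have [e [g [eE ez esum fE gz]]] := EP f fb1.
  have ed j : in_dual N Z (e j) by exact: (Ed j).
  have ex j : `|e j x| <= dn (e j) * S + geo j * N x.
    have dx := dualn_ub HN Z0 Zl (ed j) Zx.
    have [h|h] := leP (geo j) (dn (e j)); last first.
      apply: le_trans dx _; rewrite ler_wpDl//.
        by apply: mulr_ge0 => //; exact: (dualn_ge0 HN Z0).
      by apply: ler_wpM2r; [exact: (equiv_norm_ge0 HN)|exact: ltW].
    have gd : good j (e j) by apply/asboolP; split=> //; exact: ez.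
    have : (fun y => (dn (e j))^-1 * e j y) \in Sn j.
      by apply/mapP; exists (e j) => //; rewrite mem_filter gd eE.
    move=> /(nthP (fun=> 0))[k kS sk].
    have := xS (j, k); rewrite /s /= sk normrM gtr0_norm ?invr_gt0 ?(dn0 _ _ h)//.
    rewrite ler_pdivrMl ?(dn0 _ _ h)// => /le_trans; apply.
    by rewrite lerDl mulr_ge0 ?(equiv_norm_ge0 HN)// ltW// geo_gt0.
  (* The sum of the [dn (e j)] is at most [5 / 4 / c] and that of the [geo j] at most 1/4. Absorbing
     [N x / 4] leaves the constant [5 / (3 * c)], below [2 / c]. *)
  have main (t : R) : 0 < t -> N x <= 5 / 4 / c * S + N x / 4 + t.
    move=> t0; have [K KP] := gz x t Zx t0.
    have := KP K (leqnn _) => gK; rewrite -{1}fx (fE K.+1).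
    apply: le_trans (ler_norm _) _; apply: le_trans (ler_normD _ _) _.
    apply: lerD; last exact: ltW.
    apply: le_trans (ler_norm_sum _ _ _) _.
    apply: (@le_trans _ _ (\sum_(j < K.+1) (dn (e j) * S + geo j * N x))).
      by apply: ler_sum => j _; exact: ex.
    rewrite big_split/= -!mulr_suml; apply: lerD.
      by rewrite ler_wpM2r// ler_pdivlMr// mulrC; exact: esum.
    rewrite mulrC ler_wpM2l ?(equiv_norm_ge0 HN)// sum_geo.
    have := @geo_gt0 R K.+1; lra.
  have : N x <= 5 / 4 / c * S + N x / 4 by apply/ler_addgt0Pr.
  have cS : 0 <= c^-1 * S by rewrite mulr_ge0// invr_ge0 ltW.
  rewrite -!mulrA; lra.
Qed.

End SeparableEmbedding.

(** * Closing-off *)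

Section SkolemHull.
Context {G U : Type} {P : countType}.
Variables (base : G -> U) (F : P -> seq U -> U).

(** The operations accept lists of any length, so a single family with countable parameters covers
    Skolem functions of all arities. *)
Inductive hull (A : set G) : U -> Prop :=
| hull_base g : A g -> hull A (base g)
| hull_app p l : (forall u, List.In u l -> hull A u) -> hull A (F p l).

Lemma hullS (A B : set G) : A `<=` B -> hull A `<=` hull B.
Proof.
by move=> AB u; elim=> [g /AB|p l _ IH]; [exact: hull_base|exact: hull_app].
Qed.

(** Each element is built in finitely many steps from finitely many generators, which directedness
    collects in one [B k]. *)
Lemma hull_directed (I : Type) (B : I -> set G) (i0 : I) :
  (forall i j, exists k, B i `<=` B k /\ B j `<=` B k) ->
  forall u, hull (\bigcup_i B i) u -> exists i, hull (B i) u.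
Proof.
move=> dir u; elim=> [g [i _ Big]|p l _ IH].
  by exists i; exact: hull_base.
suff [i hi] : exists i, forall u, List.In u l -> hull (B i) u.
  by exists i; exact: hull_app.
elim: l IH => [|v l IHl] IH; first by exists i0.
have [|i hi] := IHl; first by move=> w wl; apply: IH; right.
have [j hj] := IH v (or_introl erefl).
have [k [ik jk]] := dir i j; exists k => w /= [<-|wl].
  exact: (hullS jk).
exact/(hullS ik)/hi.
Qed.

(** Every element of the hull is the value of a finite tree whose leaves code generators and whose
    nodes code parameters, and such trees are countable. *)
Lemma hull_countable (A : set G) : countable A -> countable (hull A).
Proof.
move=> /countable_injP[f fi].
have [[u0 _]|h] := pselect (exists u, hull A u); last first.
  rewrite (_ : hull A = set0) //; apply/seteqP; split=> // u hu.
  by apply: h; exists u.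
have /choice[z zP] : forall n, exists u, forall g, A g -> f g = n -> u = base g.
  move=> n; have [[g [Ag fg]]|h] := pselect (exists g, A g /\ f g = n).
    exists (base g) => g' Ag' fg'; congr base; apply: fi; rewrite ?inE//.
    by rewrite fg fg'.
  by exists u0 => g Ag fg; exfalso; apply: h; exists g.
pose ev := fix ev (t : GenTree.tree nat) : U := match t with
  | GenTree.Leaf n => z n
  | GenTree.Node k l => if unpickle k is Some p then F p (map ev l) else u0
  end.
apply: (@sub_countable _ _ _ (range ev)); last first.
  apply: (sub_countable (card_image_le ev _)); exact: countableP.
apply: subset_card_le => u; elim=> [g Ag|p l _ IH].
  by exists (GenTree.Leaf (f g)) => //=; exact: zP.
suff [ts tsE] : exists ts, map ev ts = l.
  by exists (GenTree.Node (pickle p) ts) => //=; rewrite pickleK tsE.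
elim: l IH => [|v l IHl] IH; first by exists [::].
have [|ts tsE] := IHl; first by move=> w wl; apply: IH; right.
have [t _ tE] := IH v (or_introl erefl).
by exists (t :: ts); rewrite /= tE tsE.
Qed.

End SkolemHull.

(** * Reflecting pairs of vectors and functionals *)

Section ReflectingSystem.
Context {R : realType} {X : normedModType R}.
Variables (N : X -> R) (K : set X).
Hypothesis HN : equiv_norm N.

(* The closing-off conditions that a countable elementary submodel would give for
   the vectors [D] and the functionals [Phi] that belong to it. *)
Record reflecting (D : set X) (Phi : set (X -> R)) : Prop := Reflecting {
  reflecting0 : D 0;
  reflecting0f : Phi (fun=> 0);
  reflecting_lin : forall (q : rat) x y, D x -> D y -> D (ratr q *: x + y);
  reflecting_bounded : forall f, Phi f -> exists M, bounded_by N f M;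
  reflecting_norming : forall x, D x ->
    exists f, [/\ Phi f, bounded_by N f 1 & f x = N x];
  reflecting_weak : forall (fs : seq (X -> R)) (qs : seq rat) (e : rat),
    (forall f, List.In f fs -> Phi f) ->
    (exists2 k, K k & forall i, (i < size fs)%N ->
      `|nth (fun=> 0) fs i k - ratr (nth 0 qs i)| < ratr e) ->
    exists k, [/\ K k, D k & forall i, (i < size fs)%N ->
      `|nth (fun=> 0) fs i k - ratr (nth 0 qs i)| < ratr e];
  reflecting_dual : forall (xs : seq X) (qs : seq rat) (e r b : rat) (f0 : X -> R),
    (forall x, List.In x xs -> D x) -> Phi f0 ->
    (exists f, [/\ bounded_by N f (ratr r), forall i, (i < size xs)%N ->
        `|f (nth 0 xs i) - ratr (nth 0 qs i)| < ratr e &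
        exists y, N y <= 1 /\ ratr b < f y - f0 y]) ->
    exists f, [/\ Phi f, bounded_by N f (ratr r), forall i, (i < size xs)%N ->
        `|f (nth 0 xs i) - ratr (nth 0 qs i)| < ratr e &
        exists y, N y <= 1 /\ ratr b < f y - f0 y]
}.

Lemma bounded_by0 : bounded_by N (fun=> 0) 1.
Proof.
split=> [a x y|x]; first by rewrite mulr0 addr0.
by rewrite normr0 mul1r equiv_norm_ge0.
Qed.

Lemma List_In_preimage (T V : Type) (h : T -> V) (S : set T) (l : seq V) :
  (forall v, List.In v l -> exists2 t, S t & h t = v) ->
  exists2 ts, (forall t, List.In t ts -> S t) & map h ts = l.
Proof.
elim: l => [|v l IH] hl; first by exists [::].
have [|ts tsS tsE] := IH; first by move=> w wl; apply: hl; right.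
have [t St tv] := hl v (or_introl erefl).
exists (t :: ts) => [t' /= [<-//|]|]; first exact: tsS.
by rewrite /= tv tsE.
Qed.

(** Vectors and functionals are closed off together, in one hull inside the product [U]; [D A] and
    [Phi A] are its two projections. Tolerances and target values are rational to keep the
    parameters countable. *)
Theorem reflecting_family (G : Type) (d : G -> X) :
  exists (D : set G -> set X) (Phi : set G -> set (X -> R)),
  [/\ forall A, reflecting (D A) (Phi A),
      forall A g, A g -> D A (d g),
      forall A B, A `<=` B -> D A `<=` D B /\ Phi A `<=` Phi B,
      forall A, countable A -> countable (D A) &
      forall (I : Type) (B : I -> set G) (i0 : I),
        (forall i j, exists k, B i `<=` B k /\ B j `<=` B k) ->
        forall x, D (\bigcup_i B i) x -> exists i, D (B i) x].
Proof.
pose U := (X * (X -> R))%type.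
pose P := (nat * (seq rat * (rat * (rat * rat))))%type : countType.
pose u0 : U := (0, fun=> 0).
(* Tags 0 to 3 ask for a rational combination, a norming functional, a point of [K] with prescribed
   values, and a functional with prescribed values. Under tag 3 the head of [l] carries [f0] and the
   tail the vectors, hence [behead]. *)
pose Q (p : P) (l : seq U) (u : U) : Prop :=
  let: (t, (qs, (e, (r, b)))) := p in
  let xs := map fst l in let fs := map snd l in
  match t with
  | 0 => u = (ratr e *: nth 0 xs 0 + nth 0 xs 1, fun=> 0)
  | 1 => [/\ u.1 = 0, bounded_by N u.2 1 & u.2 (nth 0 xs 0) = N (nth 0 xs 0)]
  | 2 => [/\ u.2 = (fun=> 0), K u.1 & forall i, (i < size fs)%N ->
          `|nth (fun=> 0) fs i u.1 - ratr (nth 0 qs i)| < ratr e]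
  | 3 => [/\ u.1 = 0, bounded_by N u.2 (ratr r), forall i, (i < size (behead xs))%N ->
        `|u.2 (nth 0 (behead xs) i) - ratr (nth 0 qs i)| < ratr e &
        exists y, N y <= 1 /\ ratr b < u.2 y - (head u0 l).2 y]
  | _ => False
  end.
(* The Skolem function returns a solution of the request when one exists, and [u0] otherwise. *)
have /choice[F0 F0P] : forall pl : P * seq U, exists u,
    (exists v, Q pl.1 pl.2 v) /\ Q pl.1 pl.2 u \/ ~ (exists v, Q pl.1 pl.2 v) /\ u = u0.
  move=> pl; have [[v Qv]|h] := pselect (exists v, Q pl.1 pl.2 v).
    by exists v; left; split=> //; exists v.
  by exists u0; right.
pose F p l := F0 (p, l).
have FQ p l v : Q p l v -> Q p l (F p l).
  by move=> Qv; case: (F0P (p, l)) => [[_]//|[h _]]; exfalso; apply: h; exists v.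
pose H := hull (fun g => (d g, fun=> 0) : U) F.
have HQ A p l v : (forall u, List.In u l -> H A u) -> Q p l v ->
    exists2 u, H A u & Q p l u.
  by move=> lA Qv; exists (F p l); [exact: hull_app|exact: FQ Qv].
have Hb A u : H A u -> exists M, bounded_by N u.2 M.
  elim=> [g _|p l _ _] /=; first by exists 1; exact: bounded_by0.
  rewrite /F; case: (F0P (p, l)) => [[_]|[_ ->]]; last by exists 1; exact: bounded_by0.
  case: p => [[|[|[|[|t]]]] [qs [e [r b]]]] /=.
  - by move=> ->; exists 1; exact: bounded_by0.
  - by case=> _ h _; exists 1.
  - by case=> -> _ _; exists 1; exact: bounded_by0.
  - by case=> _ h _ _; exists (ratr r).
  - by [].
pose D A : set X := [set x | exists f, H A (x, f)].
pose Phi A : set (X -> R) := [set f | exists x, H A (x, f)].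
have D0 A : H A u0.
  have [//| |u Hu] := HQ A (0%N, ([::], (0, (0, 0)))) [::] u0.
    by rewrite /= scaler0 addr0.
  by rewrite /= scaler0 addr0 => uE; rewrite /u0 -uE.
exists D, Phi; split.
- move=> A; split.
  + by exists (fun=> 0); exact: D0.
  + by exists 0; exact: D0.
  + move=> q x y [f Hx] [g Hy].
    have [| |u Hu] := HQ A (0%N, ([::], (q, (0, 0)))) [:: (x, f); (y, g)]
        (ratr q *: x + y, fun=> 0).
    * by move=> u /= [<-//|[<-//|]].
    * by [].
    * by move=> /= uE; exists (fun=> 0); rewrite -uE.
  + by move=> f [x Hx]; exact: (Hb _ _ Hx).
  + move=> x [f Hx]; have [g [gb gx]] := bounded_by_norming HN x.
    have [| |[u1 u2] Hu] := HQ A (1%N, ([::], (0, (0, 0)))) [:: (x, f)] (0, g).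
    * by move=> u /= [<-//|].
    * by [].
    * by move=> /= [_ h1 h2]; exists u2; split=> //; exists u1.
  + move=> fs qs e fsP [k Kk kP].
    have [|l lH lE] := @List_In_preimage U _ snd (H A) fs.
      by move=> f /fsP[x Hx]; exists (x, f).
    have [//| |[u1 u2] Hu] := HQ A (2%N, (qs, (e, (0, 0)))) l (k, fun=> 0).
    * by rewrite /= lE; split.
    * by rewrite /= lE => -[_ h1 h2]; exists u1; split=> //; exists u2.
  + move=> xs qs e r b f0 xsP [x0 Hx0] [f [fr fx fy]].
    have [|l lH lE] := @List_In_preimage U _ fst (H A) xs.
      by move=> x /xsP[g Hx]; exists (x, g).
    have [| |[u1 u2] Hu] := HQ A (3%N, (qs, (e, (r, b)))) ((x0, f0) :: l) (0, f).
    * by move=> u /= [<-//|]; exact: lH.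
    * by rewrite /= lE; split.
    * by rewrite /= lE => -[_ h1 h2 h3]; exists u2; split=> //; exists u1.
- by move=> A g Ag; exists (fun=> 0); exact: (hull_base (fun g => (d g, fun=> 0) : U) F Ag).
- move=> A B AB; split=> [x [f Hx]|f [x Hx]].
  + by exists f; exact: (hullS AB).
  + by exists x; exact: (hullS AB).
- move=> A /(hull_countable (fun g => (d g, fun=> 0) : U) F) cA.
  apply: (@sub_countable _ _ _ (fst @` H A)).
    by apply: subset_card_le => x [f Hx]; exists (x, f).
  by apply: (sub_countable _ cA); exact: card_image_le.
- move=> I B i0 dir x [f Hx]; have [i Hi] := hull_directed i0 dir Hx.
  by exists i, f.
Qed.

End ReflectingSystem.

(** * Projections *)

Lemma rat_approx (R : realType) (t e : R) : 0 < e ->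
  exists q : rat, `|t - ratr q| < e.
Proof.
move=> e0; have [|q] := @rat_in_itvoo R (t - e) (t + e); first lra.
by rewrite in_itv/= => /andP[h1 h2]; exists q; rewrite ltr_norml; lra.
Qed.

Section LinearFun.
Context {R : realType} {X : normedModType R}.
Variable f : X -> R.
Hypothesis fl : is_linear_fun f.

Lemma is_linear_fun0 : f 0 = 0.
Proof. by have := fl 1 0 0; rewrite scale1r addr0 mul1r; lra. Qed.
Lemma is_linear_funD x y : f (x + y) = f x + f y.
Proof. by rewrite -{1}(scale1r x) fl mul1r. Qed.
Lemma is_linear_funZ a x : f (a *: x) = a * f x.
Proof. by have := fl a x 0; rewrite is_linear_fun0 !addr0. Qed.
Lemma is_linear_funB x y : f (x - y) = f x - f y.
Proof. by rewrite is_linear_funD -scaleN1r is_linear_funZ mulN1r. Qed.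
End LinearFun.

Lemma equiv_norm_complete (R : realType) (X : completeNormedModType R) (N : X -> R)
    (u : nat -> X) : equiv_norm N ->
  (forall e : R, 0 < e -> exists K, forall n m, (K <= n)%N -> (K <= m)%N ->
     N (u n - u m) < e) ->
  exists y, forall e : R, 0 < e -> exists K, forall n, (K <= n)%N -> N (y - u n) < e.
Proof.
move=> HN uC; have [a a0 Na] := equiv_norm_lb HN; have [b b0 Nb] := equiv_norm_ub HN.
have : cvg (u @ \oo).
  apply: cauchy_cvg; apply: cauchy_exP => e e0.
  have [K KP] := uC _ (mulr_gt0 a0 e0).
  exists (u K); exists K => // n Kn.
  rewrite -ball_normE/=; have := KP _ _ (leqnn K) Kn.
  by move=> /(le_lt_trans (Na _)); rewrite ltr_pM2l.
move=> /cvgrPdist_lt uy; exists (lim (u @ \oo)) => e e0.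
have [K _ KP] := uy _ (divr_gt0 e0 b0); exists K => n Kn.
by apply: le_lt_trans (Nb _) _; rewrite mulrC -ltr_pdivlMr//; exact: KP.
Qed.

Section Splitting.
Context {R : realType} {X : completeNormedModType R}.
Variables (N : X -> R) (K : set X).
Hypotheses (HN : equiv_norm N) (cK : weakly_compact K) (dK : dense_in (lin_span K)).
Variables (D : set X) (Phi : set (X -> R)).
Hypothesis DPhi : reflecting N K D Phi.

Definition nclosure (D : set X) : set X :=
  [set x | forall e : R, 0 < e -> exists d, D d /\ N (x - d) < e].
Definition annihilator (Phi : set (X -> R)) : set X :=
  [set x | forall f, Phi f -> f x = 0].

Lemma nclosure_sub : D `<=` nclosure D.
Proof. by move=> x Dx e e0; exists x; rewrite subrr equiv_norm0. Qed.

(** [D] is stable under rational combinations only, so a real scalar is first replaced by a close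
    rational one; the three resulting errors are kept to [e / 3] each. *)
Lemma nclosure_closed_subspace : closed_subspace (nclosure D).
Proof.
split; first by apply: nclosure_sub; exact: reflecting0 DPhi.
split; last first.
  apply: (equiv_norm_closed HN) => x h e e0.
  have e2 : 0 < e / 2 by rewrite divr_gt0.
  have [y [Dy xy]] := h _ e2; have [d [Dd yd]] := Dy _ e2.
  exists d; split=> //; have := equiv_normD HN (x - y) (y - d).
  by rewrite addrA subrK; lra.
move=> a x y Dx Dy e e0; have Nx := equiv_norm_ge0 HN x.
have e3 : 0 < e / 3 / (N x + 1) by rewrite !divr_gt0// ltr_wpDl.
have [q aq] := rat_approx a e3.
have e3' : 0 < e / 3 / (`|ratr q : R| + 1) by rewrite !divr_gt0// ltr_wpDl.
have [d [Dd xd]] := Dx _ e3'.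
have [|d' [Dd' yd]] := Dy (e / 3); first by rewrite divr_gt0.
exists (ratr q *: d + d'); split; first exact: (reflecting_lin DPhi).
have -> : a *: x + y - (ratr q *: d + d') =
    (a - ratr q) *: x + ratr q *: (x - d) + (y - d').
  rewrite opprD addrACA; congr (_ + _).
  by rewrite scalerBl scalerBr addrA subrK.
apply: le_lt_trans (equiv_normD HN _ _) _.
apply: (@lt_le_trans _ _ (e / 3 + e / 3 + e / 3)); last lra.
apply: ltr_leD; last exact: ltW.
apply: le_lt_trans (equiv_normD HN _ _) _; rewrite !(equiv_normZ HN).
apply: ltrD.
  apply: (@le_lt_trans _ _ (`|a - ratr q| * (N x + 1))).
    by rewrite ler_wpM2l// lerDl.
  by rewrite -ltr_pdivlMr// ltr_wpDl.
apply: (@le_lt_trans _ _ ((`|ratr q : R| + 1) * N (x - d))).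
  by rewrite ler_wpM2r ?(equiv_norm_ge0 HN)// lerDl.
by rewrite mulrC -ltr_pdivlMr// ltr_wpDl.
Qed.

Lemma nclosure_separable : countable D -> separable_set (nclosure D).
Proof.
move=> cD; exists D; split=> //; split; first exact: nclosure_sub.
move=> x e Dx e0; have [a a0 Na] := equiv_norm_lb HN.
have [d [Dd xd]] := Dx _ (mulr_gt0 a0 e0); exists d; split=> //.
by rewrite -(ltr_pM2l a0); apply: le_lt_trans xd.
Qed.

Lemma annihilator_lin (a : R) x y :
  annihilator Phi x -> annihilator Phi y -> annihilator Phi (a *: x + y).
Proof.
move=> Ax Ay f Pf; have [M [fl _]] := reflecting_bounded DPhi Pf.
by rewrite fl Ax// Ay// mulr0 addr0.
Qed.

(** A point [d] of [D] near [y] has a norming functional in [Phi], and this functional does not see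
    [w]. *)
Lemma nclosure_contraction y w :
  nclosure D y -> annihilator Phi w -> N y <= N (y + w).
Proof.
move=> Dy Aw; apply/ler_addgt0Pr => e e0.
have e2 : 0 < e / 2 by rewrite divr_gt0.
have [d [Dd yd]] := Dy _ e2.
have [f [Pf [fl fb] fd]] := reflecting_norming DPhi Dd.
have h1 : N d <= N (y + w) + N (y - d).
  rewrite -fd.
  have -> : f d = f (y + w) - f (y - d).
    by rewrite (is_linear_funD fl) (is_linear_funB fl) Aw//; ring.
  have := fb (y + w); have := fb (y - d); rewrite !mul1r => h1 h2.
  have := ler_norm (f (y + w)); have := ler_norm (- f (y - d)); rewrite normrN.
  lra.
have := equiv_normD HN d (y - d); rewrite (addrC d) subrK; lra.
Qed.

Lemma weakly_open_gt (f : X -> R) (a t : R) : is_clf f ->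
  weakly_open [set x | t < `|f x - a|].
Proof.
move=> fc x /= tx; exists 1%N, (fun=> f), (`|f x - a| - t); split=> //.
split; first by rewrite subr_gt0.
move=> y /= /(_ ord0) h.
have := ler_normD (f x - f y) (f y - a).
have -> : f x - f y + (f y - a) = f x - a by ring.
rewrite (distrC (f x) (f y)); lra.
Qed.

(** If [k] does not split, the sets [U] cover [K]: a point outside all of them lies in the closure
    of [D] and agrees with [k] on [Phi]. A finite subcover involves finitely many functionals of
    [Phi], and reflection yields a point of [K] in [D] that almost agrees with [k] on them, hence is
    not covered. *)
Lemma weakly_compact_split k : K k ->
  exists2 y, nclosure D y & annihilator Phi (k - y).
Proof.
move=> Kk; apply: contrapT => h.
(* [Some n] separates from [k] by a functional of [Phi] with margin [1 / (n + 1)]; [None] separates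
   from the closed span of [D]. *)
pose U (fn : (X -> R) * option nat) : set X :=
  if fn.2 is Some n then
    [set x | Phi fn.1 /\ n.+1%:R^-1 < `|fn.1 x - fn.1 k|]
  else [set x | [/\ is_clf fn.1, forall d, D d -> fn.1 d = 0 & 0 < `|fn.1 x - 0|]].
have Uo i : weakly_open (U i).
  case: i => f [n|] x /= => [[Pf fx]|[fc fD fx]].
    have [M /(bounded_by_is_clf HN) fc] := reflecting_bounded DPhi Pf.
    have [m [g [e [gc [e0 gU]]]]] := weakly_open_gt fc fx.
    by exists m, g, e; split=> //; split=> // y /gU.
  have [m [g [e [gc [e0 gU]]]]] := weakly_open_gt fc fx.
  by exists m, g, e; split=> //; split=> // y /gU.
have [x Kx|F [fF KF]] := cK Uo.
  have [Dx|nDx] := pselect (nclosure D x).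
    apply: contrapT => nU; apply: h; exists x => // f Pf.
    have [M [fl _]] := reflecting_bounded DPhi Pf.
    rewrite (is_linear_funB fl); apply/eqP; apply: contrapT => /negP fkx.
    have [|n nP] := @near_infty_invS R `|f x - f k|.
      by rewrite normr_gt0 subr_eq0 eq_sym -subr_eq0.
    apply: nU; exists (f, Some n) => //=; split=> //; exact: nP.
  have [f [[M fb] fZ fx]] := closed_subspace_separation HN nclosure_closed_subspace nDx.
  exists (f, None) => //=; split; first exact: (bounded_by_is_clf HN fb).
    by move=> d /nclosure_sub /fZ.
  by rewrite subr0 normr_gt0.
have [s sF] := (finite_seqP F).1 fF.
pose s' := [seq fn <- s | `[< Phi fn.1 >]].
pose fs := map fst s'.
(* Both [f k'] and [f k] will be within [e] of the same rational, so [2 * e] must not exceed any of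
   the finitely many margins. *)
have [e e0 eP] : exists2 e : rat, 0 < ratr e :> R &
    forall f n, (f, Some n) \in s -> 2 * ratr e <= n.+1%:R^-1 :> R.
  elim: s {sF s' fs} => [|[f [n|]] s [e e0 eP]].
  - by exists 1 => //; rewrite rmorph1.
  - have [|q] := @rat_in_itvoo R 0 (Num.min (ratr e) (n.+1%:R^-1 / 2)).
      by rewrite lt_min e0 divr_gt0// invr_gt0.
    rewrite in_itv/= lt_min => /and3P[q0 qe qn]; exists q => // f' n'.
    rewrite inE => /predU1P[[_ ->]|/eP].
      by move: qn; set t : R := n.+1%:R^-1; lra.
    by set t : R := n'.+1%:R^-1; lra.
  - by exists e => // f' n'; rewrite inE => /predU1P[//|]; exact: eP.
have /choice[q qP] : forall f : X -> R, exists q : rat, `|f k - ratr q| < ratr e :> R.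
  by move=> f; exact: rat_approx.
have fsP f : List.In f fs -> Phi f.
  rewrite /fs /s' => h'.
  have : f \in map fst [seq fn <- s | `[< Phi fn.1 >]].
    elim: (map _ _) h' => //= a l IH [->|/IH]; rewrite inE ?eqxx// => ->.
    by rewrite orbT.
  by move=> /mapP[fn]; rewrite mem_filter => /andP[/asboolP h1 _] ->.
have [|k' [Kk' Dk' kP]] := reflecting_weak DPhi (qs := map q fs) (e := e) fsP.
  exists k => // i ifs; rewrite (nth_map (fun=> 0))//; exact: qP.
have [[f on] Ff] := KF _ Kk'; rewrite sF/= in Ff.
case: on Ff => [n|] Ff /=; last by case=> _ /(_ _ Dk') ->; rewrite subrr normr0 ltxx.
case=> Pf; apply/negP; rewrite -leNgt; apply: le_trans (eP _ _ Ff).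
have : f \in fs by apply/mapP; exists (f, Some n) => //; rewrite mem_filter Ff andbT; apply/asboolP.
move=> /(nthP (fun=> 0))[i ifs fi].
have := kP i ifs; rewrite (nth_map (fun=> 0))// fi => h1.
have := qP f; have := ler_normB (f k' - ratr (q f)) (f k - ratr (q f)).
have -> : f k' - ratr (q f) - (f k - ratr (q f)) = f k' - f k by ring.
lra.
Qed.

(** The vectors that split form a subspace containing [K], hence its dense span. As the component in
    the closure of [D] depends on the vector contractively, the components of approximants to [x]
    converge. *)
Theorem reflecting_split x :
  exists2 y, nclosure D y & annihilator Phi (x - y).
Proof.
pose S : set X := [set x | exists2 y, nclosure D y & annihilator Phi (x - y)].
have [Z0 [Zl _]] := nclosure_closed_subspace.
have Sl (a : R) u v : S u -> S v -> S (a *: u + v).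
  move=> [y Dy Ay] [y' Dy' Ay']; exists (a *: y + y'); first exact: Zl.
  by rewrite opprD addrACA -scalerBr; exact: annihilator_lin.
have S0 : S 0 by exists 0 => //; rewrite subr0 => f Pf;
  have [M [fl _]] := reflecting_bounded DPhi Pf; rewrite (is_linear_fun0 fl).
have SK : lin_span K `<=` S.
  move=> _ [n [a [v [vK ->]]]].
  elim: n a v vK => [|n IH] a v vK; first by rewrite big_ord0.
  rewrite big_ord_recl; apply: Sl; last by apply: IH => i; exact: vK.
  exact: weakly_compact_split.
have /choice[u uP] : forall n, exists u : X * X, [/\ N (x - u.1) < n.+1%:R^-1,
    nclosure D u.2 & annihilator Phi (u.1 - u.2)].
  move=> n; have i0 : 0 < n.+1%:R^-1 :> R by rewrite invr_gt0.
  have dK' z (e : R) : [set: X] z -> 0 < e -> exists d, lin_span K d /\ `|z - d| < e.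
    by move=> _; exact: dK.
  have [v [vK xv]] := equiv_norm_dense HN dK' (I : [set: X] x) i0.
  by have [y Dy Ay] := SK _ vK; exists (v, y).
have uD n m : N ((u n).2 - (u m).2) <= N ((u n).1 - (u m).1).
  have [_ Dn An] := uP n; have [_ Dm Am] := uP m.
  have Dnm : nclosure D ((u n).2 - (u m).2).
    by have := Zl (-1) _ _ Dm Dn; rewrite scaleN1r addrC.
  have Anm : annihilator Phi (((u n).1 - (u n).2) - ((u m).1 - (u m).2)).
    by have := annihilator_lin (-1) Am An; rewrite scaleN1r addrC.
  have := nclosure_contraction Dnm Anm.
  by rewrite (opprB (u m).1) addrACA (addrC (u n).2) subrK addKr.
have [e e0|y yP] := equiv_norm_complete (u := snd \o u) HN.
  have e2 : 0 < e / 2 by rewrite divr_gt0.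
  have [k kP] := near_infty_invS e2; exists k => n m kn km.
  apply: le_lt_trans (uD n m) _.
  have [xn _ _] := uP n; have [xm _ _] := uP m.
  have := equiv_normB HN (x - (u m).1) (x - (u n).1).
  rewrite opprB addrC addrA subrK => /le_lt_trans; apply.
  rewrite (splitr e); apply: ltrD.
    exact: lt_trans (kP _ km).
  exact: lt_trans (kP _ kn).
exists y.
  apply: (closed_equiv_normP HN (proj2 (proj2 nclosure_closed_subspace))) => e e0.
  have [k kP] := yP e e0; exists (u k).2; split; last exact: kP.
  by have [] := uP k.
move=> f Pf; have [M [fl fM]] := reflecting_bounded DPhi Pf.
apply/eqP; rewrite -normr_le0; apply/ler_addgt0Pr => e e0; rewrite add0r.
pose t := e / 2 / (`|M| + 1).
have M1 : 0 < `|M| + 1 by rewrite ltr_wpDl.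
have t0 : 0 < t by rewrite !divr_gt0.
have [k kP] := yP t t0; have [l lP] := near_infty_invS t0.
have [xu _ Au] := uP (maxn k l).
have yu := kP _ (leq_maxl k l); have lu := lP _ (leq_maxr k l).
rewrite /= in yu; set n := maxn k l in xu Au yu lu.
have -> : f (x - y) = f (x - (u n).1) - f (y - (u n).2).
  have := Au _ Pf; rewrite !(is_linear_funB fl) => h.
  by lra.
have bd w : N w < t -> `|f w| <= e / 2.
  move=> wt; apply: le_trans (fM _) _.
  apply: (@le_trans _ _ ((`|M| + 1) * N w)).
    by apply: ler_wpM2r; [exact: equiv_norm_ge0|rewrite (le_trans (ler_norm _))// lerDl].
  by rewrite mulrC -ler_pdivlMr// ltW.
apply: le_trans (ler_normB _ _) _; rewrite (splitr e); apply: lerD; apply: bd => //.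
exact: lt_trans lu.
Qed.

End Splitting.

(** * Flatness of the splittings *)

Section AsymptoticFlatness.
Context {R : realType} {X : completeNormedModType R}.
Variables (N : X -> R) (K : set X) (c : R).
Hypotheses (HN : equiv_norm N) (cK : weakly_compact K) (dK : dense_in (lin_span K)).
Hypotheses (c0 : 0 < c) (HK : LwsKK N c).
Variables (D : set X) (Phi : set (X -> R)).
Hypotheses (DPhi : reflecting N K D Phi) (cD : countable D).
Local Notation Z := (nclosure N D).

(** For each [n] two members of [Phi] imitate [f] at the first points of [D] and differ by more than
    [b] at a vector of the unit ball, hence also at its component [u] in [Z]. So one of them differs
    from [f] by more than [b / 2] at [u]. The chosen ones converge weak* to [f] on [Z], and the
    Kadec-Klee inequality applies to their differences from [f]. *)
Lemma reflecting_lower_estimate (f : X -> R) (y0 : X) (b r : rat) :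
  bounded_by N f 1 -> annihilator Phi y0 -> N y0 <= 1 -> ratr b < f y0 ->
  1 < ratr r :> R ->
  dualn N Z f + c * (ratr b / 2) <= ratr r.
Proof.
move=> fb Ay0 y01 by0 r1; have [fl f1] := fb.
have HZ := nclosure_closed_subspace HN DPhi.
have Z0 : Z 0 := proj1 HZ.
have Zl : forall (a : R) x y, Z x -> Z y -> Z (a *: x + y) := proj1 (proj2 HZ).
have [xs [xD xs_surj]] := countable_enumeration cD (ex_intro _ _ (reflecting0 DPhi)).
have Zxs i : Z (xs i) by exact/(nclosure_sub HN)/xD.
have xs_dense x (e : R) : Z x -> 0 < e -> exists i, N (x - xs i) < e.
  by move=> Zx e0; have [d [/xs_surj[i <-] xd]] := Zx e e0; exists i.
have fr : bounded_by N f (ratr r).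
  split=> // x; apply: le_trans (f1 x) _.
  by apply: ler_wpM2r; [exact: equiv_norm_ge0|exact: ltW].
have step n f0 (q : rat) : Phi f0 -> (exists y, N y <= 1 /\ ratr q < f y - f0 y) ->
    exists g, [/\ Phi g, bounded_by N g (ratr r),
      forall i, (i <= n)%N -> `|g (xs i) - f (xs i)| <= 2 * n.+1%:R^-1 &
      exists y, N y <= 1 /\ ratr q < g y - f0 y].
  move=> Pf0 hy.
  have [|e] := @rat_in_itvoo R 0 n.+1%:R^-1; first by rewrite invr_gt0.
  rewrite in_itv/= => /andP[e0 en].
  have /choice[p pP] : forall x, exists p : rat, `|f x - ratr p| < ratr e.
    by move=> x; exact: rat_approx.
  have [x|||g [Pg gr gx gy]] := reflecting_dual DPhi (xs := map xs (iota 0 n.+1))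
      (qs := map (p \o xs) (iota 0 n.+1)) (e := e) (r := r) (b := q) (f0 := f0).
  - elim: (iota _ _) => //= a l IH [<-|]; [exact: xD|exact: IH].
  - by [].
  - exists f; split=> // i; rewrite size_map size_iota => ni.
    rewrite !(nth_map 0%N) ?size_iota// nth_iota// add0n /=; exact: pP.
  exists g; split=> // i ni.
  have := gx i; rewrite size_map size_iota ltnS => /(_ ni).
  rewrite !(nth_map 0%N) ?size_iota ?ltnS// nth_iota ?ltnS// add0n /= => h1.
  have := pP (xs i) => h2.
  have -> : g (xs i) - f (xs i) =
     (g (xs i) - ratr (p (xs i))) - (f (xs i) - ratr (p (xs i))) by ring.
  apply: le_trans (ler_normB _ _) _.
  move: en h1 h2; set t : R := n.+1%:R^-1; set u := `|_|; set v := `|_|; lra.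
have /choice[g gP] : forall n, exists g, [/\ bounded_by N g (ratr r),
    forall i, (i <= n)%N -> `|g (xs i) - f (xs i)| <= 2 * n.+1%:R^-1 &
    exists u, [/\ Z u, N u <= 1 & ratr b / 2 < `|g u - f u|]].
  move=> n.
  (* With [f0 = 0] and threshold -1 the last requirement is met at [y = 0], so this is a plain
     imitation of [f]. *)
  have [|f1' [Pf1 f1r f1x _]] := step n (fun=> 0) (-1) (reflecting0f DPhi).
    exists 0; rewrite (equiv_norm0 HN) (is_linear_fun0 fl) subr0; split=> //.
    by rewrite rmorphN1; lra.
  have [|f2 [Pf2 f2r f2x [y [y1 yb]]]] := step n f1' b Pf1.
    by exists y0; split=> //; rewrite (Ay0 _ Pf1) subr0.
  have [u Zu Auy] := reflecting_split HN cK dK DPhi y.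
  have u1 : N u <= 1.
    by have := nclosure_contraction HN DPhi Zu Auy; rewrite addrC subrK => /le_trans; apply.
  (* Both functionals lie in [Phi] and vanish at [y - u], so [y] may be replaced by [u]; [f u] is
     then subtracted from each. *)
  have hb : ratr b < (f2 u - f u) - (f1' u - f u).
    have := Auy _ Pf1; have := Auy _ Pf2.
    rewrite (is_linear_funB (proj1 f1r)) (is_linear_funB (proj1 f2r)); lra.
  have [h|h] := ltP (ratr b / 2) `|f2 u - f u|.
    by exists f2; split=> //; exists u.
  exists f1'; split=> //; exists u; split=> //.
  have := ler_norm (f2 u - f u); have := ler_norm (- (f1' u - f u)); rewrite normrN.
  lra.
have fd : in_dual N Z f.
  by split=> [a x y _ _|]; [exact: fl|exists 1 => x _; exact: f1].
have gd n : in_dual N Z (g n).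
  have [[gl gb] _ _] := gP n.
  by split=> [a x y _ _|]; [exact: gl|exists (ratr r) => x _; exact: gb].
pose h n x := g n x - f x.
have hd n : in_dual N Z (h n) by exact: in_dualBf.
have hr n : dualn N Z (h n) <= ratr r + 1.
  apply: le_trans (dualnBf HN Z0 Zl (gd n) fd) _; apply: lerD.
    apply: (dualn_le HN Z0) => [|x _]; first by apply: le_trans (ltW r1).
    by have [[_ gb] _ _] := gP n; exact: gb.
  by apply: (dualn_le HN Z0) => // x _; exact: f1.
have hx n i : (i <= n)%N -> `|h n (xs i)| <= 2 * n.+1%:R^-1.
  by have [_ gx _] := gP n; exact: gx.
have hnull x : Z x -> (fun n => h n x) @ \oo --> (0 : R).
  move=> Zx; apply/cvgrPdist_lt => t t0.
  have [k kP] := dual_null_of_dense HN HZ Zxs xs_dense hd hr hx Zx t0.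
  by exists k => // n /= kn; rewrite sub0r normrN; exact: kP.
have := HK HZ (nclosure_separable HN cD) fd hd hnull.
rewrite (dual_normE HN Z0 fd); set L := limn_esup _; set L' := limn_esup _ => hL.
have Lb : ((ratr b / 2)%:E <= L)%E.
  rewrite leNgt; apply/negP => /limn_esup_lt_near[n0 /(_ n0 (leqnn _))].
  rewrite (dual_normE HN Z0 (hd n0)) lte_fin; apply/negP; rewrite -leNgt.
  have [_ _ [u [Zu u1 bu]]] := gP n0; apply: le_trans (ltW bu) _.
  apply: le_trans (dualn_ub HN Z0 Zl (hd n0) Zu) _.
  by rewrite ler_piMr// (dualn_ge0 HN Z0).
have Lr : (L' <= (ratr r)%:E)%E.
  apply: (@limn_esup_le_near _ _ _ 0) => n _.
  rewrite (_ : (fun x => _) = g n); last by apply/funext => x; rewrite /h; ring.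
  rewrite (dual_normE HN Z0 (gd n)) lee_fin; apply: (dualn_le HN Z0) => [|x _].
    by apply: le_trans (ltW r1).
  by have [[_ gb] _ _] := gP n; exact: gb.
rewrite -lee_fin EFinD; apply: le_trans (le_trans hL Lr).
by rewrite leeD2l// EFinM lee_wpmul2l// lee_fin ltW.
Qed.

(** For [f] norming [x + w] and [b0 = f w / N w], the preceding estimate becomes
    [dualn N Z f + c * (b0 / 2) <= 1]. The first summand times [S] bounds [f x], the second times
    [S] bounds [f w]; this is where [2 / c] comes from. *)
Theorem reflecting_flat x w S : Z x -> annihilator Phi w ->
  N x <= S -> 2 / c * N w <= S -> N (x + w) <= S.
Proof.
move=> Zx Aw xS wS.
have HZ := nclosure_closed_subspace HN DPhi.
have Z0 : Z 0 := proj1 HZ.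
have Zl : forall (a : R) x y, Z x -> Z y -> Z (a *: x + y) := proj1 (proj2 HZ).
have S0 : 0 <= S by apply: le_trans xS; exact: equiv_norm_ge0.
have [f [[fl f1] fx]] := bounded_by_norming HN (x + w).
rewrite -fx (is_linear_funD fl).
have fxb : f x <= N x by apply: le_trans (ler_norm _) _; rewrite -[N x]mul1r.
have [fw|fw] := leP (f w) 0; first lra.
have Nw : 0 < N w.
  by apply: lt_le_trans fw _; apply: le_trans (ler_norm _) _; rewrite -[N w]mul1r.
have fd : in_dual N Z f.
  by split=> [a u v _ _|]; [exact: fl|exists 1 => u _; exact: f1].
pose b0 := f w / N w.
have b00 : 0 < b0 by rewrite divr_gt0.
have key : dualn N Z f + c * (b0 / 2) <= 1.
  apply/ler_addgt0Pr => e e0.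
  have [|r] := @rat_in_itvoo R 1 (1 + e / 2); first by rewrite ltrDl divr_gt0.
  rewrite in_itv/= => /andP[r1 re].
  have [|b] := @rat_in_itvoo R (b0 - e / c) b0; first by rewrite ltrBlDr ltrDl divr_gt0.
  rewrite in_itv/= => /andP[b1 b2].
  have := @reflecting_lower_estimate f ((N w)^-1 *: w) b r (conj fl f1) _ _ _ r1.
  have Aw' : annihilator Phi ((N w)^-1 *: w).
    move=> g Pg; have [M [gl _]] := reflecting_bounded DPhi Pg.
    by rewrite (is_linear_funZ gl) (Aw _ Pg) mulr0.
  have nw : N ((N w)^-1 *: w) <= 1.
    by rewrite (equiv_normZ HN) gtr0_norm ?invr_gt0// mulVf// gt_eqF.
  have fb : ratr b < f ((N w)^-1 *: w) by rewrite (is_linear_funZ fl) mulrC.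
  move=> /(_ Aw' nw fb) h.
  have : c * (b0 - e / c) <= c * ratr b by rewrite ler_pM2l// ltW.
  rewrite mulrBr (mulrCA c e) divff ?gt_eqF// mulr1; lra.
have fx' : f x <= dualn N Z f * S.
  apply: le_trans (ler_norm _) _; apply: le_trans (dualn_ub HN Z0 Zl fd Zx) _.
  by rewrite ler_wpM2l// (dualn_ge0 HN Z0).
have fw' : f w <= c * (b0 / 2) * S.
  have -> : f w = c * (b0 / 2) * (2 / c * N w).
    by rewrite /b0; field; rewrite !gt_eqF.
  by rewrite ler_wpM2l// ltW// !mulr_gt0// invr_gt0.
apply: le_trans (lerD fx' fw') _; rewrite -mulrDl.
by rewrite ler_piMl.
Qed.

End AsymptoticFlatness.

(** * Gluing separable blocks *)

Section FlatSplit.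
Context {R : realType} {X : normedModType R}.
Variables (N : X -> R) (C : R).
Hypothesis HN : equiv_norm N.

(** A norm-one projection with range [Y] and kernel [W], for which [N (y + w)] is at most the
    maximum of [N y] and [C * N w]. *)
Record flat_split (Y W : set X) : Prop := FlatSplit {
  fs_closed : closed_subspace Y;
  fs_separable : separable_set Y;
  fs_lin : forall (a : R) x y, W x -> W y -> W (a *: x + y);
  fs_contraction : forall y w, Y y -> W w -> N y <= N (y + w);
  fs_flat : forall y w S, Y y -> W w -> N y <= S -> C * N w <= S -> N (y + w) <= S;
  fs_ex : forall x, exists y, Y y /\ W (x - y)
}.

Lemma equiv_norm_eq0 x : N x <= 0 -> x = 0.
Proof.
have [a a0 Na] := equiv_norm_lb HN => x0; apply/eqP; rewrite -normr_le0.
by rewrite -(pmulr_rle0 _ a0); apply: le_trans x0.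
Qed.

(** The splitting attached to the empty initial segment. *)
Lemma flat_split_trivial : 1 <= C -> flat_split [set 0] setT.
Proof.
move=> C1; split=> //.
- split=> //; split=> [a _ _ -> ->|]; first by rewrite /= scaler0 addr0.
  apply: (equiv_norm_closed HN) => x h /=; apply: equiv_norm_eq0.
  apply/ler_addgt0Pr => e e0; have [_ [-> ]] := h e e0.
  by rewrite subr0 add0r => /ltW.
- exists [set 0]; split; first exact: countable1.
  by split=> // _ e -> e0; exists 0; rewrite subrr normr0.
- by move=> _ w -> _; rewrite (equiv_norm0 HN) equiv_norm_ge0.
- move=> _ w S -> _ _ wS; rewrite add0r; apply: le_trans wS.
  by rewrite ler_peMl// equiv_norm_ge0.
- by move=> x; exists 0.
Qed.

Section Projection.
Variables (Y W : set X) (P : X -> X).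
Hypotheses (YW : flat_split Y W) (PP : forall x, Y (P x) /\ W (x - P x)).

(** [Y] and [W] meet only in 0: for [v] in both, contraction applied to [v] and [- v] gives
    [N v <= N 0]. *)
Lemma flat_split_proj x y : Y y -> W (x - y) -> P x = y.
Proof.
move=> Yy Wy; have [YP WP] := PP x.
have Zl := proj1 (proj2 (fs_closed YW)).
apply/eqP; rewrite -subr_eq0; apply/eqP/equiv_norm_eq0.
have Yd : Y (P x - y) by have := Zl (-1) _ _ Yy YP; rewrite scaleN1r addrC.
have Wd : W (y - P x).
  have := fs_lin YW (-1) Wy WP; rewrite scaleN1r addrC.
  by rewrite opprB addrC addrA subrK.
have := fs_contraction YW Yd Wd.
by rewrite -[X in P x - y + X]opprB subrr equiv_norm0.
Qed.

Lemma flat_split_projl (a : R) x y : P (a *: x + y) = a *: P x + P y.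
Proof.
apply: flat_split_proj.
  by apply: (proj1 (proj2 (fs_closed YW))); have [] := PP x; have [] := PP y.
rewrite opprD addrACA -scalerBr; apply: (fs_lin YW).
  by have [] := PP x.
by have [] := PP y.
Qed.

Lemma flat_split_projB x y : P (x - y) = P x - P y.
Proof.
by have := flat_split_projl (-1) y x; rewrite !scaleN1r !(addrC (- _)).
Qed.

Lemma flat_split_projN x : N (P x) <= N x.
Proof.
have [YP WP] := PP x; have := fs_contraction YW YP WP.
by rewrite addrC subrK.
Qed.

Lemma flat_split_W0 : W 0.
Proof.
have [_ WP] := PP 0; have := fs_lin YW (-1) WP WP.
by rewrite scaleN1r addNr.
Qed.

Lemma flat_split_proj_id y : Y y -> P y = y.
Proof. by move=> Yy; apply: flat_split_proj => //; rewrite subrr; exact: flat_split_W0. Qed.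

End Projection.

Lemma flat_split_proj_comp (Y W Y' W' : set X) (P P' : X -> X) :
  flat_split Y W -> (forall x, Y (P x) /\ W (x - P x)) ->
  flat_split Y' W' -> (forall x, Y' (P' x) /\ W' (x - P' x)) ->
  W' `<=` W -> forall x, P (P' x) = P x.
Proof.
move=> YW PP YW' PP' WW x; apply: (flat_split_proj YW PP); have [YP WP] := PP x => //.
have [_ /WW WP'] := PP' x.
have := fs_lin YW (-1) WP' WP; rewrite scaleN1r opprB.
by rewrite addrA subrK.
Qed.

End FlatSplit.

Section Gluing.
Context {R : realType} {X : normedModType R}.
Variables (N : X -> R) (c : R) (G : Type) (lt : G -> G -> Prop).
Variables Yp Wp Ym Wm : G -> set X.
Hypotheses (HN : equiv_norm N) (c0 : 0 < c) (c1 : c <= 1) (HK : LwsKK N c).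
Hypotheses (lt_wf : well_founded lt)
  (lt_total : forall x y, lt x y \/ x = y \/ lt y x).
Local Notation C := (2 / c).
Hypotheses (Sp : forall g, flat_split N C (Yp g) (Wp g))
  (Sm : forall g, flat_split N C (Ym g) (Wm g))
  (Ymp : forall g, Ym g `<=` Yp g) (Wpm : forall g, Wp g `<=` Wm g)
  (Ypm : forall h g, lt h g -> Yp h `<=` Ym g)
  (Wmp : forall h g, lt h g -> Wm g `<=` Wp h)
  (Ym_dense : forall g x (e : R), Ym g x -> 0 < e ->
     N x < e \/ exists h y, [/\ lt h g, Yp h y & N (x - y) < e])
  (Yp_dense : forall x (e : R), 0 < e -> exists g y, Yp g y /\ N (x - y) < e).
Variables (pp pm : G -> X -> X).
Hypotheses (ppP : forall g x, Yp g (pp g x) /\ Wp g (x - pp g x))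
  (pmP : forall g x, Ym g (pm g x) /\ Wm g (x - pm g x)).

(** [Yp g] stands for the range belonging to the segment up to and including [g], and [Ym g] for
    that of the segment strictly below; a block is the difference of the two projections. *)
Definition block g x := pp g x - pm g x.
Definition block_space g : set X := [set x | Yp g x /\ Wm g x].

Let YpB g x y : Yp g x -> Yp g y -> Yp g (x - y).
Proof.
move=> Yx Yy; have := (proj1 (proj2 (fs_closed (Sp g)))) (-1) _ _ Yy Yx.
by rewrite scaleN1r addrC.
Qed.

Lemma block_in g x : block_space g (block g x).
Proof.
have [Y1 W1] := ppP g x; have [Y2 W2] := pmP g x; split.
  by apply: YpB => //; exact: Ymp.
have := fs_lin (Sm g) (-1) (Wpm W1) W2; rewrite scaleN1r opprB addrA.
by rewrite subrK.
Qed.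

Lemma blockl g (a : R) x y : block g (a *: x + y) = a *: block g x + block g y.
Proof.
rewrite /block (flat_split_projl HN (Sp g) (ppP g)) (flat_split_projl HN (Sm g) (pmP g)).
by rewrite opprD addrACA scalerBr.
Qed.

Lemma blockB g x y : block g (x - y) = block g x - block g y.
Proof. by have := blockl g (-1) y x; rewrite !scaleN1r !(addrC (- _)). Qed.

Lemma blockN g x : N (block g x) <= 2 * N x.
Proof.
apply: le_trans (equiv_normB HN _ _) _.
have := flat_split_projN (Sp g) (ppP g) x.
have := flat_split_projN (Sm g) (pmP g) x; lra.
Qed.

Lemma block_lt h g x y : lt h g -> Yp h y -> block g (x - y) = block g x.
Proof.
move=> hg Yy; have Ymy := Ypm hg Yy.
rewrite /block (flat_split_projB HN (Sp g) (ppP g)) (flat_split_projB HN (Sm g) (pmP g)).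
rewrite (flat_split_proj_id HN (Sp g) (ppP g) (Ymp Ymy)).
rewrite (flat_split_proj_id HN (Sm g) (pmP g) Ymy).
by rewrite opprB addrA subrK.
Qed.

Lemma block_gt g k x : lt k g -> block k (pm g x) = block k x.
Proof.
move=> kg; rewrite /block.
rewrite (flat_split_proj_comp HN (Sp k) (ppP k) (Sm g) (pmP g) (Wmp kg)).
rewrite (flat_split_proj_comp HN (Sm k) (pmP k) (Sm g) (pmP g))//.
exact: subset_trans (Wmp kg) (@Wpm k).
Qed.

(** Closedness of [Wm g] is not assumed; a limit point is in [Wm g] because the contraction [pm g],
    which vanishes on [Wm g], vanishes there too. *)
Lemma block_space_closed g : closed_subspace (block_space g).
Proof.
have [Y0 [Yl Yc]] := fs_closed (Sp g); split.
  by split=> //; exact: flat_split_W0 (Sm g) (pmP g).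
split=> [a x y [Yx Wx] [Yy Wy]|].
  by split; [exact: Yl|exact: (fs_lin (Sm g))].
apply: (equiv_norm_closed HN) => x h; split.
  apply: (closed_equiv_normP HN Yc) => e /h[z [[Yz _] xz]]; by exists z.
have [_ W2] := pmP g x.
suff -> : x = x - pm g x by [].
rewrite (equiv_norm_eq0 HN (x := pm g x)) ?subr0//.
apply/ler_addgt0Pr => e /h[z [[Yz Wz] xz]]; rewrite add0r.
have z0 : pm g z = 0.
  apply: (flat_split_proj HN (Sm g) (pmP g)); last by rewrite subr0.
  exact: (proj1 (fs_closed (Sm g))).
rewrite -[pm g x]subr0 -z0 -(flat_split_projB HN (Sm g) (pmP g)).
by apply: le_trans (flat_split_projN (Sm g) (pmP g) _) (ltW xz).
Qed.

Lemma block_space_separable g : separable_set (block_space g).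
Proof.
have [D [cD [DY Dd]]] := fs_separable (Sp g).
exists [set block g d | d in D]; split.
  by apply: (sub_countable _ cD); exact: card_image_le.
split=> [_ [d _ <-]|z e [Yz Wz] e0]; first exact: block_in.
have [a a0 Na] := equiv_norm_lb HN.
have e1 : 0 < a * e / 2 by rewrite divr_gt0// mulr_gt0.
have [d [Dd' zd]] := equiv_norm_dense HN Dd Yz e1.
exists (block g d); split; first by exists d.
have bz : block g z = z.
  rewrite /block (flat_split_proj_id HN (Sp g) (ppP g) Yz).
  rewrite (_ : pm g z = 0) ?subr0//; apply: (flat_split_proj HN (Sm g) (pmP g)).
    exact: (proj1 (fs_closed (Sm g))).
  by rewrite subr0.
rewrite -(ltr_pM2l a0); apply: le_lt_trans (Na _) _.
have -> : z - block g d = block g (z - d).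
  by rewrite blockB bz.
apply: le_lt_trans (blockN _ _) _; lra.
Qed.

(** Induction along [lt]: the part of [x] below [g] is approximated by some [y] in [Yp h] with [h]
    below [g]. Blocks strictly between [h] and [g] see only the error, so large blocks sit at [g] or
    at most at [h]. *)
Lemma block_c0 x (e : R) : 0 < e -> finite_set [set g | e <= N (block g x)].
Proof.
move=> e0; have e4 : 0 < e / 4 by rewrite divr_gt0.
have small k w : N w < e / 4 -> ~ (e <= N (block k w)).
  by move=> we eb; have := blockN k w; lra.
have fin g : finite_set [set h | (lt h g \/ h = g) /\ e <= N (block h x)].
  elim/(well_founded_ind lt_wf): g => g IH.
  have [Yx _] := pmP g x.
  have [xe|[h [y [hg Yy xy]]]] := Ym_dense Yx e4.
    apply: (sub_finite_set _ (finite_set1 g)) => k /= [[kg|//] ek].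
    by exfalso; apply: (small k _ xe); rewrite block_gt.
  apply: (@sub_finite_set _ _ ([set k | (lt k h \/ k = h) /\ e <= N (block k x)] `|` [set g])).
    move=> k /= [[kg|->] ek]; last by right.
    have [kh|[kh|hk]] := lt_total k h; [by left; split=> //; left|by left; split=> //; right|].
    by exfalso; apply: (small k _ xy); rewrite (block_lt _ hk Yy) block_gt.
  by rewrite finite_setU; split; [exact: IH|exact: finite_set1].
have [g [y [Yy xy]]] := Yp_dense x e4.
apply: (sub_finite_set _ (fin g)) => k /= ek; split=> //.
have [kg|[kg|gk]] := lt_total k g; [by left|by right|].
by exfalso; apply: (small k _ xy); rewrite (block_lt _ gk Yy).
Qed.

(** Induction along [lt]: [pp g x = pm g x + block g x], the flat estimate takes a maximum and not a
    sum, and [pm g x] is approximated from the earlier ranges. The bound [S] therefore never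
    grows. *)
Lemma block_norming x S : 0 <= S -> (forall g, C * N (block g x) <= S) -> N x <= S.
Proof.
move=> S0 hS.
(* The point [y] is fixed by [pp h], so it is within [e] of [pp h v = pp h x], whose norm is at most
   [S]. *)
have approx h y v (e : R) : N (pp h x) <= S -> pp h v = pp h x -> Yp h y ->
    N (v - y) < e -> N v <= S + 2 * e.
  move=> hx hv Yy vy.
  have h1 : N (y - pp h x) < e.
    rewrite -hv -(flat_split_proj_id HN (Sp h) (ppP h) Yy).
    rewrite -(flat_split_projB HN (Sp h) (ppP h)).
    apply: le_lt_trans (flat_split_projN (Sp h) (ppP h) _) _.
    by rewrite (equiv_norm_distC HN).
  have h2 := equiv_normD HN (v - y) y; rewrite subrK in h2.
  have h3 := equiv_normD HN (y - pp h x) (pp h x); rewrite subrK in h3.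
  lra.
have ppS g : N (pp g x) <= S.
  elim/(well_founded_ind lt_wf): g => g IH.
  have [Yx _] := pmP g x; have [_ Wb] := block_in g x.
  have -> : pp g x = pm g x + block g x by rewrite addrC subrK.
  apply: (fs_flat (Sm g)) => //.
  apply/ler_addgt0Pr => e e0; have e2 : 0 < e / 2 by rewrite divr_gt0.
  have [xe|[h [y [hg Yy xy]]]] := Ym_dense Yx e2; first lra.
  have := approx h y (pm g x) (e / 2) (IH _ hg) _ Yy xy.
  rewrite (flat_split_proj_comp HN (Sp h) (ppP h) (Sm g) (pmP g) (Wmp hg)).
  by move=> /(_ erefl); lra.
apply/ler_addgt0Pr => e e0; have e2 : 0 < e / 2 by rewrite divr_gt0.
have [g [y [Yy xy]]] := Yp_dense x e2.
by have := approx g y x (e / 2) (ppS g) erefl Yy xy; lra.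
Qed.

Lemma gluing_embedding (g0 : G) : iso_into_c0 X (G * (nat * nat)).
Proof.
have /choice[s sP] : forall g, exists s : nat * nat -> X -> R,
  [/\ forall p, dual_ball N (block_space g) 1 (s p),
      forall x, block_space g x -> in_c0 (fun p => s p x) &
      forall x S, block_space g x -> (forall p, `|s p x| <= S) -> N x <= C * S].
  move=> g; exact: (separable_embedding HN (block_space_closed g)
    (block_space_separable g) c0 c1 HK).
pose T x (gp : G * (nat * nat)) := s gp.1 gp.2 (block gp.1 x).
have sb g p y : block_space g y -> `|s g p y| <= N y.
  by have [sb _ _] := sP g => By; have := (proj2 (sb p)) _ By; rewrite mul1r.
have Tub x gp : `|T x gp| <= 2 * N x.
  by apply: le_trans (sb _ _ _ (block_in _ _)) (blockN _ _).
have [a a0 Na] := equiv_norm_lb HN; have [b b0 Nb] := equiv_norm_ub HN.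
have Cp : 0 < C by rewrite divr_gt0.
exists T; split; [|split].
- move=> x e e0.
  apply: (@sub_finite_set _ _ (\bigcup_(g in [set g | e <= N (block g x)])
     [set (g, p) | p in [set p | e <= `|s g p (block g x)|]])).
    move=> [g p] /= egp; exists g => /=.
      by apply: le_trans egp (sb _ _ _ (block_in _ _)).
    by exists p.
  apply: bigcup_finite; first exact: block_c0.
  move=> g _; apply: finite_image; have [_ sc _] := sP g.
  exact: (sc _ (block_in g x)).
- move=> t x y; apply/funext => -[g p]; rewrite /T /= blockl.
  have [sb' _ _] := sP g; apply: (proj1 (sb' p)); exact: block_in.
(* One factor [C] comes from the embedding of each block, the other from [block_norming]; the factor
   2 is that of [blockN]. *)
- exists (a / (C * C)), (2 * b); split; first by rewrite divr_gt0// mulr_gt0.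
  split; first by rewrite mulr_gt0.
  move=> x.
  have ubT : ubound [set `|T x gp| | gp in [set: G * (nat * nat)]] (2 * N x).
    by move=> _ [gp _ <-].
  have le_sup gp : `|T x gp| <= supnorm (T x).
    by apply: ub_le_sup; [exists (2 * N x)|exists gp].
  split; last first.
    apply: (@le_trans _ _ (2 * N x)); last by rewrite -mulrA ler_pM2l.
    by apply: ge_sup => //; exists `|T x (g0, (0, 0)%N)|, (g0, (0, 0)%N).
  have sup0 : 0 <= supnorm (T x) by apply: le_trans (normr_ge0 _) (le_sup (g0, (0, 0)%N)).
  have : N x <= C * (C * supnorm (T x)).
    apply: block_norming => [|g].
      by apply: mulr_ge0; [exact: ltW|apply: mulr_ge0 => //; exact: ltW].
    rewrite ler_pM2l//; have [_ _ sn] := sP g; apply: sn; first exact: block_in.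
    by move=> p; exact: (le_sup (g, p)).
  move=> /(le_trans (Na x)).
  move=> h; rewrite mulrAC ler_pdivrMr; last exact: mulr_gt0.
  by apply: le_trans h _; rewrite mulrA (mulrC (supnorm _)).

Qed.

End Gluing.

(** * The omega_1-chain of splittings *)

Lemma countable_setU1 (T : Type) (A : set T) x : countable A -> countable (A `|` [set x]).
Proof.
move=> cA; rewrite -bigcup2E; apply: bigcup_countable; first exact: countableP.
by case=> [|[|n]] _; [exact: cA|exact: countable1|exact: countable0].
Qed.

(** The order is lexicographic, with the second factor ordered by its codes; an initial segment lies
    in a countable set times [T]. *)
Lemma card_omega1_prod (G : Type) (T : countType) (t0 : T) :
  card_omega1 G -> card_omega1 (G * T).
Proof.
move=> [unc [lt [wf [tr [tot seg]]]]]; split.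
  move=> cGT; apply: unc; apply: (@sub_countable _ _ _ (fst @` [set: G * T])).
    by apply: subset_card_le => g _; exists (g, t0).
  by apply: (sub_countable _ cGT); exact: card_image_le.
exists (fun a b => lt a.1 b.1 \/ a.1 = b.1 /\ (pickle a.2 < pickle b.2)%N).
split; [|split; [|split]].
- move=> [g t]; elim/(well_founded_ind wf): g t => g IHg t.
  have [n tn] : exists n, (pickle t < n)%N by exists (pickle t).+1.
  elim: n t tn => [|n IHn] t tn; first by rewrite ltn0 in tn.
  constructor=> -[h u] /= [hg|[-> ut]]; first exact: IHg.
  by apply: IHn; exact: leq_trans ut _.
- move=> [g t] [h u] [k v] /= [gh|[-> tu]] [hk|[<- uv]].
  + by left; exact: tr hk.
  + by left.
  + by left.
  + by right; split=> //; exact: ltn_trans uv.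
- move=> [g t] [h u] /=; have [gh|[->|hg]] := tot g h.
  + by left; left.
  + have [tu|ut|tu] := ltngtP (pickle t) (pickle u).
    * by left; right.
    * by right; right; right.
    * by right; left; rewrite (pcan_inj pickleK tu).
  + by right; right; left.
- move=> [g t] /=.
  have cg : countable ([set h | lt h g] `|` [set g]).
    exact: countable_setU1.
  apply: (sub_countable _ (countableX cg (countableP [set: T]))).
  by apply: subset_card_le => -[h u] /= [hg|[-> _]]; split=> //; [left|right].
Qed.

Lemma nclosureS (R : realType) (X : completeNormedModType R) (N : X -> R) (A B : set X) :
  A `<=` B -> nclosure N A `<=` nclosure N B.
Proof. by move=> AB x Ax e /Ax[d [/AB Bd xd]]; exists d. Qed.

Lemma annihilatorS (R : realType) (X : completeNormedModType R) (A B : set (X -> R)) :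
  A `<=` B -> annihilator B `<=` annihilator A.
Proof. by move=> AB x Bx f /AB; exact: Bx. Qed.

(** A dense family indexed by [G] has countable initial segments; closing off each of them gives an
    increasing chain of flat splittings, to which the gluing lemma applies. *)
Theorem WCG_LwsKK_iso_into_c0 (R : realType) (X : completeNormedModType R)
    (N : X -> R) (c : R) :
  @density_omega1 R X -> @WCG R X -> equiv_norm N -> 0 < c -> c <= 1 -> LwsKK N c ->
  exists G : Type, card_omega1 G /\ iso_into_c0 X G.
Proof.
move=> [_ [G [d [cG dd]]]] [K [cK dK]] HN c0 c1 HK.
have [unc [lt [wf [tr [tot seg]]]]] := cG.
have [g0] : inhabited G.
  apply: contrapT => nG; apply: unc; rewrite (_ : [set: G] = set0)//.
  by apply/seteqP; split=> // g _; apply: nG.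
have [D [Phi [DPhi Dd DS Dc Ddir]]] := reflecting_family K HN d.
pose lo g : set G := [set h | lt h g].
pose le g : set G := [set h | lt h g \/ h = g].
have cle g : countable (le g).
  have -> : le g = lo g `|` [set g] by apply/seteqP; split=> h.
  by apply: countable_setU1; exact: seg.
have lole g : lo g `<=` le g by move=> h; left.
have lelo h g : lt h g -> le h `<=` lo g.
  by move=> hg k [kh|->//]; exact: tr hg.
have C1 : 1 <= 2 / c by rewrite ler_pdivlMr// mul1r (le_trans c1)// ler1n.
have fs A : countable A ->
    flat_split N (2 / c) (nclosure N (D A)) (annihilator (Phi A)).
  move=> cA; have cD := Dc _ cA; split.
  - exact: (nclosure_closed_subspace HN (DPhi A)).
  - exact: nclosure_separable.
  - by move=> t x y; exact: (annihilator_lin (DPhi A)).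
  - by move=> y w; exact: (nclosure_contraction HN (DPhi A)).
  - by move=> y w S; exact: (reflecting_flat HN cK dK c0 HK (DPhi A) cD).
  - by move=> x; have [y Yy Wy] := reflecting_split HN cK dK (DPhi A) x; exists y.
pose Yp g := nclosure N (D (le g)).
pose Wp g := annihilator (Phi (le g)).
(* Even the empty segment may have a nonzero hull, which no earlier range approximates; at the least
   element the range is therefore 0. *)
pose Ym g := if `[< lo g !=set0 >] then nclosure N (D (lo g)) else [set 0].
pose Wm g := if `[< lo g !=set0 >] then annihilator (Phi (lo g)) else setT.
have Sp g : flat_split N (2 / c) (Yp g) (Wp g) by exact: fs.
have Sm g : flat_split N (2 / c) (Ym g) (Wm g).
  rewrite /Ym /Wm; case: asboolP => _; first by apply: fs; exact: seg.
  exact: flat_split_trivial.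
have /choice[pp ppP] : forall g, exists p : X -> X, forall x, Yp g (p x) /\ Wp g (x - p x).
  by move=> g; have /choice[p pP] := fs_ex (Sp g); exists p.
have /choice[pm pmP] : forall g, exists p : X -> X, forall x, Ym g (p x) /\ Wm g (x - p x).
  by move=> g; have /choice[p pP] := fs_ex (Sm g); exists p.
exists (G * (nat * nat))%type; split; first exact: card_omega1_prod (0, 0)%N cG.
have lone h g : lt h g -> `[< lo g !=set0 >] by move=> hg; apply/asboolP; exists h.
apply: (@gluing_embedding R X N c G lt Yp Wp Ym Wm HN c0 c1 HK wf tot Sp Sm _ _ _ _ _ _ pp pm ppP pmP g0).
- move=> g; rewrite /Ym; case: asboolP => _.
    exact: (nclosureS (proj1 (DS _ _ (@lole g)))).
  by move=> _ ->; exact: (proj1 (fs_closed (Sp g))).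
- move=> g; rewrite /Wm; case: asboolP => _ //.
  exact: (annihilatorS (proj2 (DS _ _ (@lole g)))).
- move=> h g hg; rewrite /Ym (lone _ _ hg).
  exact: (nclosureS (proj1 (DS _ _ (lelo _ _ hg)))).
- move=> h g hg; rewrite /Wm (lone _ _ hg).
  exact: (annihilatorS (proj2 (DS _ _ (lelo _ _ hg)))).
- move=> g x e; rewrite /Ym; case: asboolP => [[h0 h0g]|_]; last first.
    by move=> -> e0; left; rewrite equiv_norm0.
  move=> Yx e0; right; have [y [Dy xy]] := Yx e e0.
  (* The segments up to [h], for [h] below [g], are directed with union [lo g], so each element of
     [D (lo g)] already appears in some [D (le h)]. *)
  pose B (i : {h | lt h g}) := le (sval i).
  have loE : lo g = \bigcup_i B i.
    apply/seteqP; split=> [h hg|h [i _ Bh]]; last exact: (lelo _ _ (svalP i)).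
    by exists (exist _ h hg) => //; right.
  have lels h k : lt h k -> le h `<=` le k.
    by move=> hk; exact: subset_trans (lelo _ _ hk) (lole k).
  rewrite loE in Dy; have [|i Di] := Ddir _ B (exist _ h0 h0g) _ _ Dy.
    move=> i j; have [ij|[ij|ji]] := tot (sval i) (sval j).
    - by exists j; split=> //; exact: lels.
    - by exists j; rewrite /B ij; split.
    - by exists i; split=> //; exact: lels.
  by exists (sval i), y; split=> //; [exact: (svalP i)|exact: (nclosure_sub HN)].
- move=> x e e0.
  have dd' z (t : R) : [set: X] z -> 0 < t -> exists y, range d y /\ `|z - y| < t.
    by move=> _; exact: dd.
  have [y [[g _ <-] xy]] := equiv_norm_dense HN dd' (I : [set: X] x) e0.
  by exists g, (d g); split=> //; apply: (nclosure_sub HN); apply: Dd; right.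
Qed.

(** * The sup norm on a subspace of c_0 *)

Lemma finite_set_list (T : Type) (F : set T) : finite_set F ->
  exists s : seq T, forall x, F x <-> List.In x s.
Proof.
move=> fF; have [s sE] := (@finite_seqP {classic T} F).1 fF; exists s => x.
rewrite sE /=; elim: (s : seq {classic T}) => [|y l IH]; first by split.
rewrite inE /=; split.
  by move=> /predU1P[->|/IH]; [left|right].
by move=> [->|/IH h]; rewrite ?eqxx// h orbT.
Qed.

Definition infinitely_many (J : set nat) := forall k, exists2 n, (k <= n)%N & J n.

Lemma infinitely_manyU (J J1 J2 : set nat) : infinitely_many J -> J `<=` J1 `|` J2 ->
  infinitely_many J1 \/ infinitely_many J2.
Proof.
move=> iJ JJ; have [h1|h1] := pselect (infinitely_many J1); first by left.
right=> k; apply: contrapT => h2; apply: h1 => l; have [n] := iJ (maxn k l).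
rewrite geq_max => /andP[kn ln] /JJ[J1n|J2n]; first by exists n.
by exfalso; apply: h2; exists n.
Qed.

Section Pigeonhole.
Context {R : realType}.
Variable e : R.
Hypothesis e0 : 0 < e.

(** Induction on the number of strips of height [e]: infinitely many indices fall into the top
    strip, or infinitely many below it. *)
Lemma oscillation_pigeonhole1 (psi : nat -> R) (a : R) k (J : set nat) :
  infinitely_many J -> (forall n, J n -> a <= psi n <= a + k%:R * e) ->
  exists J', [/\ J' `<=` J, infinitely_many J' &
    forall m n, J' m -> J' n -> `|psi m - psi n| <= e].
Proof.
elim: k J => [|k IH] J iJ hJ.
  exists J; split=> // m n /hJ; rewrite mul0r addr0 => /andP[h1 h2] /hJ.
  by rewrite mul0r addr0 => /andP[h3 h4]; rewrite ler_norml; have := e0; lra.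
have [|h|h] := @infinitely_manyU J (J `&` [set n | psi n <= a + k%:R * e])
    (J `&` [set n | a + k%:R * e < psi n]) iJ.
- by move=> n Jn; have [h|h] := leP (psi n) (a + k%:R * e); [left|right].
- have [n [Jn /= an]|J' [JJ iJ' J'P]] := IH _ h.
    by have /andP[-> _] := hJ _ Jn.
  by exists J'; split=> // n /JJ[].
- exists (J `&` [set n | a + k%:R * e < psi n]); split=> // m n [Jm /= hm] [Jn /= hn].
  have /andP[_] := hJ _ Jm; have /andP[_] := hJ _ Jn.
  rewrite -natr1 mulrDl mul1r ler_norml; move: hm hn; set u := k%:R * e.
  by move=> h1 h2 h3 h4; apply/andP; split; lra.
Qed.

Lemma oscillation_pigeonhole (I : Type) (l : seq I) (psi : I -> nat -> R) (B : R)
    (J : set nat) :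
  infinitely_many J -> (forall i n, J n -> `|psi i n| <= B) ->
  exists J', [/\ J' `<=` J, infinitely_many J' &
    forall i m n, List.In i l -> J' m -> J' n -> `|psi i m - psi i n| <= e].
Proof.
move=> + hB; elim: l J hB => [|i l IH] J hB iJ; first by exists J; split.
have [J1 [JJ1 iJ1 J1P]] := IH J hB iJ.
(* This many strips of height [e], starting at [- B], reach up to [B]. *)
pose k := (Num.trunc (2 * B / e)).+1.
have [n J1n|J2 [JJ2 iJ2 J2P]] := @oscillation_pigeonhole1 (psi i) (- B) k J1 iJ1.
  have := hB i n (JJ1 _ J1n); rewrite ler_norml => /andP[-> /= h].
  have : 2 * B / e < k%:R by exact: truncnS_gt.
  rewrite ltr_pdivrMr//; lra.
exists J2; split=> //; first exact: subset_trans JJ2 JJ1.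
move=> j m n /= [<-|jl] J2m J2n; first exact: J2P.
by apply: J1P => //; exact: JJ2.
Qed.

End Pigeonhole.

Section SupNorm.
Context {R : realType} {X : normedModType R} {G : Type}.
Variables (T : X -> G -> R) (a b : R) (g0 : G).
Hypotheses (Tc0 : forall x, in_c0 (T x))
  (Tl : forall (t : R) (x y : X), T (t *: x + y) = (fun g => t * T x g + T y g))
  (a0 : 0 < a) (b0 : 0 < b)
  (Tab : forall x, a * `|x| <= supnorm (T x) /\ supnorm (T x) <= b * `|x|).
Local Notation N := (fun x => supnorm (T x)).

Lemma in_c0_bounded (u : G -> R) : in_c0 u -> exists M, forall g, `|u g| <= M.
Proof.
move=> uc; have [s sE] := finite_set_list (uc 1 ltr01).
suff [M MP] : exists M, 1 <= M /\ forall g, List.In g s -> `|u g| <= M.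
  exists M => g; have [M1 hM] := MP.
  have [h|h] := leP 1 `|u g|; first by apply: hM; apply/sE.
  by apply: le_trans (ltW h) M1.
elim: s {sE} => [|g s [M [M1 MP]]]; first by exists 1.
exists (Num.max M `|u g|); split; first by rewrite le_max M1.
by move=> h /= [<-|/MP hM]; rewrite le_max ?lexx ?orbT// hM.
Qed.

Lemma supnorm_ge x g : `|T x g| <= N x.
Proof.
have [M MP] := in_c0_bounded (Tc0 x); apply: ub_le_sup; last by exists g.
by exists M => _ [h _ <-].
Qed.

Lemma supnorm_le x M : (forall g, `|T x g| <= M) -> N x <= M.
Proof.
by move=> h; apply: ge_sup => [|_ [g _ <-]//]; exists `|T x g0|, g0.
Qed.

Lemma coord0 g : T 0 g = 0.
Proof.
by have := Tl 1 0 0; rewrite scale1r addr0 => /(congr1 (fun f => f g)); lra.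
Qed.
Lemma coordZ t x g : T (t *: x) g = t * T x g.
Proof. by have := Tl t x 0; rewrite addr0 => ->; rewrite coord0 addr0. Qed.
Lemma coordD x y g : T (x + y) g = T x g + T y g.
Proof. by have := Tl 1 x y; rewrite scale1r => ->; rewrite mul1r. Qed.
Lemma coordB x y g : T (x - y) g = T x g - T y g.
Proof. by rewrite coordD -scaleN1r coordZ mulN1r. Qed.

Lemma supnorm_equiv_norm : equiv_norm N.
Proof.
split=> [x y|]; last split=> [t x|].
- apply: supnorm_le => g; rewrite coordD (le_trans (ler_normD _ _))//.
  by rewrite lerD// supnorm_ge.
- have le s y : N (s *: y) <= `|s| * N y.
    apply: supnorm_le => g; rewrite coordZ normrM ler_wpM2l//; exact: supnorm_ge.
  apply/eqP; rewrite eq_le le/=; have [->|t0] := eqVneq t 0.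
    rewrite normr0 mul0r; exact: le_trans (normr_ge0 _) (supnorm_ge _ g0).
  have := le t^-1 (t *: x); rewrite scalerA mulVf// scale1r normfV.
  by rewrite ler_pdivlMl ?normr_gt0.
- by exists a, b.
Qed.

(** Argument by contradiction: adding [w] to an almost norming [z] raises the norm by at most [e],
    whereas [phi + phin n] gains about half the norm of [phin n]. Halving the difference of two
    vectors is what makes the constant 1/2. *)
Lemma supnorm_LwsKK : LwsKK N (1 / 2).
Proof.
have HN := supnorm_equiv_norm.
move=> Z HZ sZ phi phin pd pnd pn0.
have Z0 : Z 0 := proj1 HZ.
have Zl : forall (a : R) x y, Z x -> Z y -> Z (a *: x + y) := proj1 (proj2 HZ).
have dE f : in_dual N Z f -> dual_norm N Z f = (dualn N Z f)%:E.
  exact: (dual_normE HN Z0).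
have sd n : in_dual N Z (fun x => phi x + phin n x) by exact: in_dualD.
rewrite (dE _ pd) leNgt; apply/negP.
set V := limn_esup _; set L := limn_esup _; set A := dualn N Z phi => hV.
have lim_ge0 (u : nat -> X -> R) : (0 <= limn_esup (fun n => dual_norm N Z (u n)))%E.
  rewrite leNgt; apply/negP => /limn_esup_lt_near[n1 /(_ n1 (leqnn _))].
  by rewrite ltNge (dual_norm_ge0 HN Z0).
have L0 : (0 <= L)%E by exact: lim_ge0.
have V0 : (0 <= V)%E by exact: lim_ge0.
(* The strict gap between the two sides is witnessed by reals [t < t'], which also covers an
   infinite [L]. *)
have [t [t' [tt' Vt tL]]] : exists t t' : R,
    [/\ t < t', (V < t%:E)%E & ((2 * (t' - A))%:E < L)%E].
  have Vf : (V < +oo)%E by exact: lt_le_trans hV (leey _).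
  move: V0 L0 Vf hV; case: (V) => [v| |]//; case: (L) => [l| |]//= v0 l0 _.
    rewrite -EFinM -EFinD lte_fin => h.
    exists (v + (A + 1 / 2 * l - v) / 3), (v + (A + 1 / 2 * l - v) * 2 / 3).
    by rewrite !lte_fin; split; lra.
  by move=> _; exists (v + 1), (v + 2); rewrite lte_fin ltry; split=> //; lra.
have t0 : 0 < t by rewrite -lte_fin; exact: le_lt_trans Vt.
have [n0 n0P] := limn_esup_lt_near Vt.
set l := 2 * (t' - A) in tL.
(* The final comparison is [t' - 3 * e] against [t * (1 + e)]; [e * (t + 5) <= t' - t] makes it
   fail. *)
pose e := Num.min 1 ((t' - t) / (t + 5)).
have e0 : 0 < e by rewrite lt_min ltr01 divr_gt0 ?subr_gt0// addr_gt0.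
have et : e * (t + 5) <= t' - t.
  by rewrite -ler_pdivlMr ?addr_gt0// ge_min lexx orbT.
pose J : set nat := [set n | l < dualn N Z (phin n)].
have iJ : infinitely_many J.
  move=> k; apply: contrapT => h; move: tL; apply/negP; rewrite -leNgt.
  apply: (@limn_esup_le_near _ _ _ k) => n kn; rewrite dE// lee_fin leNgt.
  by apply/negP => ln; apply: h; exists n.
have [z [Zz z1 pz]] : exists z, [/\ Z z, N z <= 1 & A - e < phi z].
  by apply: (dualn_gt HN Z0 Zl pd); rewrite -/A; lra.
have /choice[zn znP] : forall n, exists y, J n -> [/\ Z y, N y <= 1 & l < phin n y].
  move=> n; have [Jn|h] := pselect (J n); last by exists 0.
  by have [y yP] := dualn_gt HN Z0 Zl (pnd n) Jn; exists y.
have [s sE] := finite_set_list (Tc0 z e0).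
(* [None] stands for [phi] itself, so that [phi (zn n)] and [phi (zn m)] almost agree along with the
   coordinates. *)
pose psi (i : option G) n := if i is Some g then T (zn n) g else phi (zn n).
have psiB i n : J n -> `|psi i n| <= Num.max 1 A.
  move=> /znP[Zy y1 _]; rewrite le_max; case: i => [g|] /=.
    by rewrite (le_trans (supnorm_ge _ _) y1).
  suff -> : `|phi (zn n)| <= A by rewrite orbT.
  apply: le_trans (dualn_ub HN Z0 Zl pd Zy) _; rewrite ler_piMr//.
  exact: (dualn_ge0 HN Z0).
have [J' [JJ' iJ' J'P]] := @oscillation_pigeonhole R e e0 _ (None :: map Some s) psi _ J iJ psiB.
have [m _ J'm] := iJ' 0%N.
have [Zm m1 _] := znP _ (JJ' _ J'm).
have near0 y : Z y -> exists k, forall n, (k <= n)%N -> `|phin n y| < e.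
  move=> Zy; have /cvgrPdist_lt/(_ e e0)[k _ kP] := pn0 _ Zy.
  by exists k => n kn; have := kP n kn; rewrite sub0r normrN.
have [k1 k1P] := near0 _ Zz; have [k2 k2P] := near0 _ Zm.
have [n] := iJ' (maxn n0 (maxn k1 k2)); rewrite !geq_max => /and3P[nn0 nk1 nk2] J'n.
have [Zn zn1 lzn] := znP _ (JJ' _ J'n).
(* On the large coordinates of [z] the two vectors almost agree; elsewhere [|T z g| < e] and the
   half difference is at most 1. *)
pose w := 2^-1 *: (zn n - zn m).
have ZB x y : Z x -> Z y -> Z (x - y).
  by move=> Zx Zy; have := Zl (-1) _ _ Zy Zx; rewrite scaleN1r addrC.
have Zw : Z w by have := Zl 2^-1 _ _ (ZB _ _ Zn Zm) Z0; rewrite addr0.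
have Zzw : Z (z + w) by have := Zl 1 _ _ Zz Zw; rewrite scale1r.
have Nzw : N (z + w) <= 1 + e.
  apply: supnorm_le => g; rewrite coordD coordZ coordB.
  have [h|h] := leP e `|T z g|.
    have gs : List.In (Some g) (None :: map Some s).
      by right; apply: List.in_map; apply/sE.
    have := J'P _ _ _ gs J'n J'm => /= hg.
    apply: le_trans (ler_normD _ _) _; rewrite normrM gtr0_norm ?invr_gt0//.
    have := supnorm_ge z g; lra.
  apply: le_trans (ler_normD _ _) _; rewrite normrM gtr0_norm ?invr_gt0//.
  have := ler_normB (T (zn n) g) (T (zn m) g).
  have := supnorm_ge (zn n) g; have := supnorm_ge (zn m) g; lra.
have pw : `|phi (zn n) - phi (zn m)| <= e.
  exact: (J'P None n m (or_introl erefl) J'n J'm).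
have vn := n0P _ nn0; rewrite (dE _ (sd n)) lte_fin in vn.
have := dualn_ub HN Z0 Zl (sd n) Zzw.
have fE f : in_dual N Z f -> f (z + w) = f z + 2^-1 * (f (zn n) - f (zn m)).
  move=> fd; have := (proj1 fd) 1 _ _ Zz Zw; rewrite scale1r => ->.
  by rewrite mul1r (in_dualZ Z0 _ fd (ZB _ _ Zn Zm)) (in_dualB fd).
rewrite (fE _ pd) (fE _ (pnd n)).
set v := dualn N Z _ in vn *; set lhs := `|_| => hl.
have v0 : 0 <= v by exact: (dualn_ge0 HN Z0).
have h1 : lhs <= t * (1 + e).
  apply: le_trans hl _; apply: ler_pM => //; first exact: (equiv_norm_ge0 HN).
  exact: ltW.
have := k1P _ nk1; have := k2P _ nk2; rewrite !ltr_norml => /andP[q1 q2] /andP[q3 q4].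
move: pw; rewrite ler_norml => /andP[q5 q6].
have := ler_norm (phi z + 2^-1 * (phi (zn n) - phi (zn m)) +
  (phin n z + 2^-1 * (phin n (zn n) - phin n (zn m)))); rewrite -/lhs.
move: et lzn; rewrite /l; lra.
Qed.

End SupNorm.

(** * Invariant sets and atoms *)

Section InvariantSets.
Context {R : realType} {X : completeNormedModType R} {G : Type}.
Variables (T : X -> G -> R) (a b : R) (g0 : G).
Hypotheses (Tc0 : forall x, in_c0 (T x))
  (Tl : forall (t : R) (x y : X), T (t *: x + y) = (fun g => t * T x g + T y g))
  (a0 : 0 < a) (b0 : 0 < b)
  (Tab : forall x, a * `|x| <= supnorm (T x) /\ supnorm (T x) <= b * `|x|).
Local Notation N := (fun x => supnorm (T x)).
Let HN : equiv_norm N := supnorm_equiv_norm g0 Tc0 Tl a0 b0 Tab.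
Let TN x g : `|T x g| <= N x := supnorm_ge Tc0 x g.

Definition cutoff (A : set G) (u : G -> R) g := if `[< A g >] then u g else 0.

Lemma cutoffT A u g : A g -> cutoff A u g = u g.
Proof. by move=> Ag; rewrite /cutoff asboolT. Qed.
Lemma cutoffF A u g : ~ A g -> cutoff A u g = 0.
Proof. by move=> Ag; rewrite /cutoff asboolF. Qed.

Definition invariant_set (A : set G) := forall x, exists y, T y = cutoff A (T x).

(** Approximants of [u] are Cauchy for [N], and completeness of [X] supplies the limit. *)
Lemma closed_range (u : G -> R) :
  (forall e : R, 0 < e -> exists y, forall g, `|T y g - u g| <= e) ->
  exists y, T y = u.
Proof.
move=> h; have /choice[v vP] : forall n, exists y, forall g, `|T y g - u g| <= n.+1%:R^-1.
  by move=> n; apply: h; rewrite invr_gt0.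
have [e e0|y yP] := equiv_norm_complete (u := v) HN.
  have e4 : 0 < e / 4 by rewrite divr_gt0.
  have [K KP] := near_infty_invS e4; exists K => n m Kn Km.
  apply: (@le_lt_trans _ _ (e / 2)); last lra.
  apply: (supnorm_le g0) => g; rewrite (coordB Tl).
  have -> : T (v n) g - T (v m) g = (T (v n) g - u g) - (T (v m) g - u g) by ring.
  apply: le_trans (ler_normB _ _) _.
  have h1 := le_lt_trans (vP n g) (KP _ Kn).
  have h2 := le_lt_trans (vP m g) (KP _ Km); lra.
exists y; apply/funext => g; apply/eqP; rewrite -subr_eq0 -normr_le0.
apply/ler_addgt0Pr => e e0; rewrite add0r.
have e2 : 0 < e / 2 by rewrite divr_gt0.
have [K KP] := yP _ e2; have [L LP] := near_infty_invS e2.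
pose n := maxn K L.
have h1 := le_lt_trans (vP n g) (LP n (leq_maxr _ _)).
have h2 := le_lt_trans (TN (y - v n) g) (KP n (leq_maxl _ _)).
rewrite (coordB Tl) in h2.
have -> : T y g - u g = (T y g - T (v n) g) + (T (v n) g - u g) by ring.
apply: le_trans (ler_normD _ _) _; lra.
Qed.

Lemma invariant_setC A : invariant_set A -> invariant_set (~` A).
Proof.
move=> iA x; have [y yE] := iA x; exists (x - y); apply/funext => g.
rewrite (coordB Tl) yE; have [Ag|nAg] := pselect (A g).
  by rewrite cutoffT// cutoffF ?subrr//; apply.
by rewrite cutoffF// cutoffT// subr0.
Qed.

Lemma invariant_setI A B : invariant_set A -> invariant_set B -> invariant_set (A `&` B).
Proof.
move=> iA iB x; have [y yE] := iA x; have [z zE] := iB y; exists z.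
apply/funext => g; rewrite zE; have [Bg|nBg] := pselect (B g); last first.
  by rewrite !cutoffF// => -[].
rewrite cutoffT// yE; have [Ag|nAg] := pselect (A g); first by rewrite !cutoffT.
by rewrite !cutoffF// => -[].
Qed.

Lemma invariant_setT : invariant_set setT.
Proof. by move=> x; exists x; apply/funext => g; rewrite cutoffT. Qed.

(** Only finitely many coordinates of [x] exceed [e], and a finite intersection [B] already removes
    those outside the whole intersection. Restriction to [B] is then within [e] of the desired
    one. *)
Lemma invariant_bigcap (Q : set (set G)) :
  (forall A, Q A -> invariant_set A) -> invariant_set [set g | forall A, Q A -> A g].
Proof.
move=> iQ x; apply: closed_range => e e0.
have [s sE] := finite_set_list (Tc0 x e0).
have [B [iB QB sB]] : exists B, [/\ invariant_set B,
    (forall g, (forall A, Q A -> A g) -> B g) &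
    forall g, List.In g s -> B g -> forall A, Q A -> A g].
  elim: s {sE} => [|h s [B [iB QB sB]]].
    by exists setT; split=> //; exact: invariant_setT.
  have [hQ|hQ] := pselect (forall A, Q A -> A h).
    by exists B; split=> // g /= [<-//|]; exact: sB.
  have [A [QA Ah]] : exists A, Q A /\ ~ A h.
    apply: contrapT => h'; apply: hQ => A QA; apply: contrapT => Ah.
    by apply: h'; exists A.
  exists (B `&` A); split.
  - by apply: invariant_setI => //; exact: iQ.
  - by move=> g gQ; split; [exact: QB|exact: gQ].
  - by move=> g /= [<- [] //|gs [Bg _]]; exact: sB.
have [y yE] := iB x; exists y => g; rewrite yE.
have [gQ|gQ] := pselect (forall A, Q A -> A g).
  by rewrite !cutoffT ?subrr ?normr0 ?ltW//; exact: QB.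
rewrite [cutoff _ _ g in X in _ - X]cutoffF// subr0.
have [Bg|nBg] := pselect (B g); last by rewrite cutoffF// normr0 ltW.
rewrite cutoffT// leNgt; apply/negP => eg; apply: gQ.
by apply: sB => //; apply/sE => /=; exact: ltW.
Qed.

(** The bound [2 * e] off [F] is what averaging produces. *)
Definition approximable (F : seq G) (qs : seq rat) (e : R) :=
  exists y, (forall i, (i < size F)%N -> `|T y (nth g0 F i) - ratr (nth 0 qs i)| <= e) /\
    forall g, ~ List.In g F -> `|T y g| <= 2 * e.

Definition candidate (F : seq G) (qs : seq rat) (e : R) (m : nat) x :=
  N x <= m%:R /\
  forall i, (i < size F)%N -> `|T x (nth g0 F i) - ratr (nth 0 qs i)| < e.

(* Candidates whose large coordinates off [F] are pairwise disjoint average to an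
   element that is small off [F]. *)
Lemma candidates_average F qs (e : R) m : 0 < e ->
  (forall B : seq G, exists2 x, candidate F qs e m x &
     forall g, List.In g B -> ~ List.In g F -> `|T x g| < e) ->
  approximable F qs e.
Proof.
move=> e0 hB.
(* [B] collects the coordinates that are large in some summand. Each new summand is below [e] on [B]
   off [F], so off [F] a coordinate receives a large contribution, at most [m], only once. *)
have avg k : exists y (B : seq G),
    [/\ forall i, (i < size F)%N ->
          `|T y (nth g0 F i) - k%:R * ratr (nth 0 qs i)| <= k%:R * e,
        forall g, ~ List.In g F -> ~ List.In g B -> `|T y g| <= k%:R * e &
        forall g, ~ List.In g F -> `|T y g| <= k%:R * e + m%:R].
  elim: k => [|k [y [B [yF yB yG]]]].
    exists 0, [::]; split=> [i _|g _ _|g _].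
    - by rewrite (coord0 Tl) !mul0r subrr normr0.
    - by rewrite (coord0 Tl) mul0r normr0.
    - by rewrite (coord0 Tl) mul0r normr0 add0r.
  have [x [xm xF] xB] := hB B.
  have [s sE] := finite_set_list (Tc0 x e0).
  exists (y + x), (B ++ s); split=> [i iF|g gF gB|g gF]; rewrite (coordD Tl).
  - have -> : T y (nth g0 F i) + T x (nth g0 F i) - k.+1%:R * ratr (nth 0 qs i) =
      (T y (nth g0 F i) - k%:R * ratr (nth 0 qs i)) +
      (T x (nth g0 F i) - ratr (nth 0 qs i)) by rewrite -natr1; ring.
    apply: le_trans (ler_normD _ _) _; rewrite -natr1 mulrDl mul1r.
    by apply: lerD; [exact: yF|apply: ltW; exact: xF].
  - have gB' : ~ List.In g B by move=> h; apply: gB; apply/List.in_or_app; left.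
    have gs : `|T x g| < e.
      rewrite ltNge; apply/negP => h; apply: gB; apply/List.in_or_app; right.
      exact/sE.
    apply: le_trans (ler_normD _ _) _; rewrite -natr1 mulrDl mul1r.
    by apply: lerD; [exact: yB|exact: ltW].
  - apply: le_trans (ler_normD _ _) _; rewrite -natr1 mulrDl mul1r.
    have [gB|gB] := pselect (List.In g B).
      by rewrite addrAC; apply: lerD; [exact: yG|apply: ltW; exact: xB].
    have := yB _ gF gB; have := le_trans (TN x g) xm; have := ltW e0.
    by set u := k%:R * e; lra.
(* With [m <= k * e] the average has coordinates at most [(k * e + m) / k <= 2 * e] off [F]. *)
pose k := (Num.trunc (m%:R / e)).+1.
have mk : m%:R <= k%:R * e by rewrite -ler_pdivrMr// ltW// truncnS_gt.
have k0 : 0 < k%:R :> R by rewrite ltr0n.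
have [y [B [yF _ yG]]] := avg k; exists (k%:R^-1 *: y); split=> [i iF|g gF].
  rewrite (coordZ Tl).
  have -> : k%:R^-1 * T y (nth g0 F i) - ratr (nth 0 qs i) =
     k%:R^-1 * (T y (nth g0 F i) - k%:R * ratr (nth 0 qs i)).
    by rewrite mulrBr mulrA mulVf ?gt_eqF// mul1r.
  by rewrite normrM gtr0_norm ?invr_gt0// ler_pdivrMl//; exact: yF.
rewrite (coordZ Tl) normrM gtr0_norm ?invr_gt0// ler_pdivrMl//.
by have := yG _ gF; move: mk; set u := k%:R * e; rewrite mulrCA -/u; lra.
Qed.

(** If a request is not approximable, averaging fails, so some finite [B] meets a large coordinate
    off [F] of every candidate. Let [A] be closed under passing from [F] to such [B]. With [F] the
    large coordinates of [x] inside [A], the vector [x] itself is a candidate small on [B] off [F],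
    so the request is approximable, and the result is near the restriction of [x] to [A]. *)
Lemma countable_invariant_set (A0 : set G) : countable A0 ->
  exists A, [/\ countable A, A0 `<=` A & invariant_set A].
Proof.
move=> cA0.
have /choice[Bs BsP] : forall p : seq G * (seq rat * (rat * nat)), exists B : seq G,
    let: (F, (qs, (e, m))) := p in 0 < ratr e :> R ->
    (exists2 x, candidate F qs (ratr e) m x &
       forall g, List.In g B -> ~ List.In g F -> `|T x g| < ratr e) ->
    approximable F qs (ratr e).
  move=> [F [qs [e m]]]; apply: contrapT => h.
  have [e0|e0] := ltP (0 : R) (ratr e); last first.
    by apply: h; exists [::]; rewrite ltNge e0.
  have happ : ~ approximable F qs (ratr e) by move=> h'; apply: h; exists [::].
  apply: happ; apply: (candidates_average e0 (m := m)) => B; apply: contrapT => h'.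
  by apply: h; exists B => _ [x xc xB]; exfalso; apply: h'; exists x.
pose P := (seq rat * (rat * (nat * nat)))%type : countType.
(* The parameter [j] runs through the entries of the finite list; past its end the value is [g0]. *)
pose op (p : P) (l : seq G) : G :=
  let: (qs, (e, (m, j))) := p in nth g0 (Bs (l, (qs, (e, m)))) j.
exists (hull id op A0); split.
- exact: hull_countable.
- by move=> g Ag; exact: (hull_base id op Ag).
move=> x; apply: closed_range => t t0.
have t3 : 0 < t / 3 by rewrite divr_gt0.
have [e] := rat_in_itvoo t3; rewrite in_itv/= => /andP[e0 et].
set A := hull id op A0.
have fF : finite_set [set g | A g /\ ratr e <= `|T x g|].
  by apply: (sub_finite_set _ (Tc0 x e0)) => g [].
have [F FE] := finite_set_list fF.
have /choice[q qP] : forall g, exists q : rat, `|T x g - ratr q| < ratr e.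
  by move=> g; exact: rat_approx.
pose m := (Num.trunc (N x)).+1.
have xc : candidate F (map q F) (ratr e) m x.
  split; first by apply: ltW; exact: truncnS_gt.
  by move=> i iF; rewrite (nth_map g0)//; exact: qP.
have FA g : List.In g F -> A g by move=> /FE[].
have BA g : List.In g (Bs (F, (map q F, (e, m)))) -> A g.
  move=> gB; have [j jB <-] : exists2 j, (j < size (Bs (F, (map q F, (e, m)))))%N &
      nth g0 (Bs (F, (map q F, (e, m)))) j = g.
    elim: (Bs _) gB => //= h l IH [->|/IH[j jl <-]]; first by exists 0%N.
    by exists j.+1.
  exact: (@hull_app G G P id op A0 (map q F, (e, (m, j))) F FA).
have [|y [yF yG]] := BsP (F, (map q F, (e, m))) e0.
  exists x => // g /BA Ag gF; rewrite ltNge; apply/negP => eg.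
  by apply: gF; apply/FE.
exists y => g; have [gF|gF] := pselect (List.In g F).
  rewrite cutoffT; last exact: FA.
  have [i iF gE] : exists2 i, (i < size F)%N & nth g0 F i = g.
    elim: (F) gF => //= h l IH [->|/IH[j jl <-]]; first by exists 0%N.
    by exists j.+1.
  have := yF i iF; rewrite (nth_map g0)// gE => h1.
  have h2 := qP g.
  have -> : T y g - T x g = (T y g - ratr (q g)) - (T x g - ratr (q g)) by ring.
  apply: le_trans (ler_normB _ _) _; lra.
have h1 := yG g gF; have [Ag|nAg] := pselect (A g); last first.
  by rewrite cutoffF// subr0; lra.
rewrite cutoffT//.
have h2 : `|T x g| < ratr e.
  by rewrite ltNge; apply/negP => eg; apply: gF; apply/FE.
apply: le_trans (ler_normB _ _) _; lra.
Qed.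

End InvariantSets.

Section Atoms.
Context {R : realType} {X : completeNormedModType R} {G : Type}.
Variables (T : X -> G -> R) (a b : R) (g0 : G).
Hypotheses (Tc0 : forall x, in_c0 (T x))
  (Tl : forall (t : R) (x y : X), T (t *: x + y) = (fun g => t * T x g + T y g))
  (a0 : 0 < a) (b0 : 0 < b)
  (Tab : forall x, a * `|x| <= supnorm (T x) /\ supnorm (T x) <= b * `|x|).
Local Notation N := (fun x => supnorm (T x)).
Let HN : equiv_norm N := supnorm_equiv_norm g0 Tc0 Tl a0 b0 Tab.
Let TN x g : `|T x g| <= N x := supnorm_ge Tc0 x g.
Local Notation invariant := (invariant_set T).

Definition atom (g : G) : set G := [set h | forall A, invariant A /\ A g -> A h].

Lemma atom_self g : atom g g. Proof. by move=> A []. Qed.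

Lemma atom_invariant g : invariant (atom g).
Proof.
by apply: (@invariant_bigcap _ _ _ T a b g0 Tc0 Tl a0 b0 Tab
  [set A | invariant A /\ A g]) => A [].
Qed.

Lemma atom_countable g : countable (atom g).
Proof.
have [A [cA Ag iA]] := countable_invariant_set g0 Tc0 Tl a0 b0 Tab (countable1 g).
apply: (sub_countable _ cA); apply: subset_card_le => h; apply; split=> //.
exact: Ag.
Qed.

(** If [g] were outside [atom h], then [atom g] minus [atom h] would be an invariant set containing
    [g] but not [h]. *)
Lemma atom_eq g h : atom g h -> atom h = atom g.
Proof.
move=> gh; have hg : atom h `<=` atom g.
  by move=> k hk; apply: hk; split; [exact: atom_invariant|].
apply/seteqP; split=> //.
have [ghh|ngh] := pselect (atom h g).
  by move=> k gk; apply: gk; split; [exact: atom_invariant|].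
have iD : invariant (atom g `&` ~` atom h).
  apply: invariant_setI; first exact: atom_invariant.
  by apply: (invariant_setC Tl); exact: atom_invariant.
have [|_ []] := gh _ (conj iD _).
  by split=> //; exact: atom_self.
exact: atom_self.
Qed.

Definition supported (A : set G) : set X := [set x | forall g, ~ A g -> T x g = 0].

(** Countably many finite rational patterns describe the supported vectors up to small errors; one
    vector is chosen for each pattern that occurs. Division by [1 + N (u n)] bounds the sequence,
    and the scalar [t] undoes it. *)
Lemma supported_separable (A : set G) : countable A -> A !=set0 ->
  exists s : nat -> X, (forall n, supported A (s n) /\ N (s n) <= 1) /\
    forall x (e : R), supported A x -> 0 < e -> exists n (t : R), N (x - t *: s n) < e.
Proof.
move=> cA Ane; have [z [zA zs]] := countable_enumeration cA Ane.
pose P := (seq (nat * rat) * nat)%type : countType.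
pose fits (p : P) x := [/\ supported A x,
  (forall iq, iq \in p.1 -> `|T x (z iq.1) - ratr iq.2| < p.2.+1%:R^-1) &
  forall g, ~ (exists2 iq, iq \in p.1 & z iq.1 = g) -> `|T x g| < p.2.+1%:R^-1].
have supp0 : supported A 0 by move=> g _; rewrite (coord0 Tl).
have /choice[u uP] : forall n, exists x, supported A x /\
    forall p, unpickle n = Some p -> (exists y, fits p y) -> fits p x.
  move=> n; case: (unpickle n) => [p|]; last by exists 0.
  have [[y yp]|h] := pselect (exists y, fits p y).
    by exists y; split=> [|p' [<-]//]; have [] := yp.
  by exists 0; split=> // p' [<-].
have scN x : 0 < 1 + N x by rewrite ltr_pwDl// (equiv_norm_ge0 HN).
exists (fun n => (1 + N (u n))^-1 *: u n); split=> [n|x e Ax e0].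
  split; first by move=> g ng; rewrite (coordZ Tl) (proj1 (uP n))// mulr0.
  have := equiv_normZ HN (1 + N (u n))^-1 (u n); rewrite /= => ->.
  by rewrite gtr0_norm ?invr_gt0// ler_pdivrMl// mulr1 lerDr.
have e4 : 0 < e / 4 by rewrite divr_gt0.
have [k kP] := near_infty_invS e4; have {kP} ke := kP k (leqnn _).
set d : R := k.+1%:R^-1 in ke.
have d0 : 0 < d by rewrite invr_gt0.
have [F FE] := finite_set_list (Tc0 x d0).
have FA g : List.In g F -> A g.
  move=> /FE /= dg; apply: contrapT => /Ax xg.
  by move: dg; rewrite xg normr0 leNgt d0.
have [l lF lP] : exists2 l : seq (nat * rat),
    (forall g, List.In g F -> exists2 iq, iq \in l & z iq.1 = g) &
    forall iq, iq \in l -> `|T x (z iq.1) - ratr iq.2| < d.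
  elim: F FA {FE} => [|g F IH] FA; first by exists [::].
  have [|l lF lP] := IH; first by move=> h hF; apply: FA; right.
  have [i zi] := zs g (FA g (or_introl erefl)).
  have [q qP] := rat_approx (T x g) d0.
  exists ((i, q) :: l) => [h /= [<-|/lF[iq iql zh]]|iq].
  - by exists (i, q); rewrite ?inE ?eqxx.
  - by exists iq; rewrite // inE iql orbT.
  - by rewrite inE => /predU1P[->|/lP//] /=; rewrite zi.
have fx : fits (l, k) x.
  split=> //= g ng; rewrite ltNge; apply/negP => dg; apply: ng.
  by apply: lF; apply/FE.
pose n := pickle ((l, k) : P).
have [_ /(_ (l, k))] := uP n; rewrite pickleK => /(_ erefl) h.
have [_ ul uG] := h (ex_intro _ x fx).
exists n, (1 + N (u n)); rewrite scalerA divff ?gt_eqF// scale1r.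
apply: (@le_lt_trans _ _ (e / 2)); last lra.
apply: (supnorm_le g0) => g; rewrite (coordB Tl).
have [[iq iql zg]|ng] := pselect (exists2 iq, iq \in l & z iq.1 = g).
  have := ul _ iql; have := lP _ iql; rewrite zg /= -/d => h1 h2.
  have -> : T x g - T (u n) g = (T x g - ratr iq.2) - (T (u n) g - ratr iq.2) by ring.
  apply: le_trans (ler_normB _ _) _; lra.
have := uG _ ng; have [_ _ /(_ _ ng)] := fx; rewrite /= -/d => h1 h2.
apply: le_trans (ler_normB _ _) _; lra.
Qed.

(** Distinct atoms are disjoint, so a signed sum of [y A] over [n] atoms still has norm at most 1,
    while [f] takes a value of at least [n * e] on it; hence [n] is bounded. *)
Lemma atoms_finite (f : X -> R) (M e : R) (y : set G -> X) :
  bounded_by N f M -> 0 < e ->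
  (forall g, supported (atom g) (y (atom g)) /\ N (y (atom g)) <= 1) ->
  finite_set [set A | (exists g, A = atom g) /\ e <= `|f (y A)|].
Proof.
move=> [fl fM] e0 yP; apply: contrapT => /infinite_set_fset inf.
have comb (s : seq (set G)) : uniq s ->
    (forall A, A \in s -> (exists g, A = atom g) /\ e <= `|f (y A)|) ->
  exists v, [/\ forall g, (forall A, A \in s -> ~ A g) -> T v g = 0,
        forall g, `|T v g| <= 1 & (size s)%:R * e <= f v].
  elim: s => [|A s IH].
    move=> _ _; exists 0; split=> [g _|g|]; rewrite ?(coord0 Tl)// ?normr0//.
    by rewrite mul0r (is_linear_fun0 fl).
  move=> /= /andP[As us] sB.
  have [//||v [vs v1 fv]] := IH; first by move=> C Cs; apply: sB; rewrite inE Cs orbT.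
  have [[g Ag] eA] := sB A (mem_head _ _).
  have [yA y1] := yP g; rewrite -Ag in yA y1.
  pose w := Num.sg (f (y A)) *: y A.
  have Tw h : `|T w h| <= `|T (y A) h|.
    rewrite (coordZ Tl) normrM normr_sg; case: (_ != 0); rewrite ?mul1r// mul0r//.
  have dis h : A h -> T v h = 0.
    move=> Ah; apply: vs => C Cs Ch.
    have [[k Ck] _] := sB C (mem_behead (s := A :: s) Cs).
    have AC : A = C.
      by rewrite Ag Ck -(@atom_eq g h) -?Ag// -(@atom_eq k h) -?Ck.
    by move: As; rewrite AC Cs.
  exists (v + w); split=> [h hA|h|].
  - rewrite (coordD Tl) vs ?add0r; last by move=> C Cs; apply: hA; rewrite inE Cs orbT.
    apply/eqP; rewrite -normr_le0; apply: le_trans (Tw h) _.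
    by rewrite (yA h) ?normr0//; apply: hA; exact: mem_head.
  - rewrite (coordD Tl); have [Ah|nAh] := pselect (A h).
      rewrite dis// add0r; apply: le_trans (Tw h) _; exact: le_trans (TN _ _) y1.
    have -> : T w h = 0 by rewrite (coordZ Tl) yA// mulr0.
    by rewrite addr0.
  - rewrite (is_linear_funD fl) (is_linear_funZ fl) -normrEsg.
    by rewrite /= -natr1 mulrDl mul1r lerD.
have [B BS kB] := inf (Num.trunc (`|M| / e)).+1.
have [|v [_ v1 fv]] := comb _ (finmap.fset_uniq B); first by move=> A /BS.
have fv1 : f v <= `|M|.
  apply: le_trans (ler_norm _) _; apply: le_trans (fM v) _.
  apply: le_trans (ler_wpM2r (equiv_norm_ge0 HN v) (ler_norm M)) _.
  by rewrite ler_piMr//; apply: (supnorm_le g0).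
have : `|M| / e < (size (finmap.enum_fset B))%:R.
  by apply: lt_le_trans (truncnS_gt _) _; rewrite ler_nat.
rewrite ltr_pdivrMr//; lra.
Qed.

End Atoms.

(** * The weakly compact generating set *)

Section LinSpan.
Context {R : realType} {X : normedModType R}.
Variable K : set X.

Lemma lin_span0 : lin_span K 0.
Proof. by exists 0%N, (fun=> 0), (fun=> 0); split=> [[]//|]; rewrite big_ord0. Qed.

Lemma lin_spanZ (t : R) x : K x -> lin_span K (t *: x).
Proof. by move=> Kx; exists 1%N, (fun=> t), (fun=> x); split=> //; rewrite big_ord1. Qed.

Lemma lin_spanD x y : lin_span K x -> lin_span K y -> lin_span K (x + y).
Proof.
move=> [n [a [v [vK ->]]]] [m [a' [v' [vK' ->]]]].
exists (n + m)%N, (fun i => match fintype.split i with inl j => a j | inr k => a' k end),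
  (fun i => match fintype.split i with inl j => v j | inr k => v' k end); split.
  by move=> i; case: (fintype.split i).
rewrite big_split_ord/=; congr (_ + _); apply: eq_bigr => i _.
  by rewrite (unsplitK (inl i)).
by rewrite (unsplitK (inr i)).
Qed.

End LinSpan.

(** A member of the cover that contains 0 contains a basic weak neighbourhood of 0, which only
    finitely many points of [K] escape. *)
Lemma weakly_compact_null (R : realType) (X : normedModType R) (K : set X) : K 0 ->
  (forall f (e : R), is_clf f -> 0 < e -> finite_set [set x | K x /\ e <= `|f x|]) ->
  weakly_compact K.
Proof.
move=> K0 Kf I U Uo KU; have [i0 _ U0] := KU _ K0.
have [n [f [e [fc [e0 fU]]]]] := Uo _ _ U0.
have f0 i : f i 0 = 0 by exact: is_linear_fun0 (proj1 (fc i)).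
pose E := \bigcup_(i in [set: 'I_n]) [set x | K x /\ e <= `|f i x|].
have fE : finite_set E.
  by apply: bigcup_finite => // i _; exact: Kf.
have /choice[j jP] : forall x, exists i, K x -> U i x.
  move=> x; have [Kx|nK] := pselect (K x); last by exists i0.
  by have [i _ Ui] := KU _ Kx; exists i.
exists (i0 |` [set j x | x in E]); split.
  by rewrite finite_setU; split; [exact: finite_set1|exact: finite_image].
move=> x Kx; have [Ex|nEx] := pselect (E x).
  by exists (j x); [right; exists x|exact: jP].
exists i0; first by left.
apply: fU => i /=; rewrite f0 subr0 ltNge; apply/negP => ex.
by apply: nEx; exists i.
Qed.

Section SubspaceOfC0WCG.
Context {R : realType} {X : completeNormedModType R} {G : Type}.
Variables (T : X -> G -> R) (a b : R) (g0 : G).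
Hypotheses (Tc0 : forall x, in_c0 (T x))
  (Tl : forall (t : R) (x y : X), T (t *: x + y) = (fun g => t * T x g + T y g))
  (a0 : 0 < a) (b0 : 0 < b)
  (Tab : forall x, a * `|x| <= supnorm (T x) /\ supnorm (T x) <= b * `|x|).
Local Notation N := (fun x => supnorm (T x)).
Let HN : equiv_norm N := supnorm_equiv_norm g0 Tc0 Tl a0 b0 Tab.

(** The dense sequences of the atoms, divided by [n + 1], form with 0 a set to which
    [weakly_compact_null] applies. Their span is dense because the large coordinates of [x] meet
    finitely many atoms. *)
Theorem subspace_c0_WCG : @WCG R X.
Proof.
have /choice[s sP] : forall A : set G, exists s : nat -> X, (exists g, A = atom T g) ->
    (forall n, supported T A (s n) /\ N (s n) <= 1) /\
    forall x (e : R), supported T A x -> 0 < e -> exists n (t : R), N (x - t *: s n) < e.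
  move=> A; have [[g Ag]|h] := pselect (exists g, A = atom T g); last by exists (fun=> 0).
  have [||s h] := supported_separable g0 Tc0 Tl a0 b0 Tab (A := A).
  - by rewrite Ag; exact: (atom_countable g0 Tc0 Tl a0 b0 Tab).
  - by exists g; rewrite Ag; exact: atom_self.
  - by exists s.
pose K : set X := [set x | x = 0 \/ exists g n, x = n.+1%:R^-1 *: s (atom T g) n].
have sA g n : supported T (atom T g) (s (atom T g) n) /\ N (s (atom T g) n) <= 1.
  by have [h _] := sP _ (ex_intro _ g erefl); exact: h.
exists K; split.
  apply: weakly_compact_null; first by left.
  move=> f e fc e0; have [M fM] := is_clf_bounded_by HN fc; have [fl fb] := fM.
  (* From this index on, division by [n + 1] alone brings the value of [f] below [e]; for each
     smaller [n], [atoms_finite] applies. *)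
  pose L := (Num.trunc (`|M| / e)).+1.
  apply: (@sub_finite_set _ _ (\bigcup_(n in `I_L)
     [set n.+1%:R^-1 *: s A n | A in
        [set A | (exists g, A = atom T g) /\ e <= `|f (s A n)|]])).
    move=> x [[->|[g [n ->]]] ex].
      by move: ex; rewrite (is_linear_fun0 fl) normr0 leNgt e0.
    have n0 : 0 < n.+1%:R :> R by [].
    move: ex; rewrite (is_linear_funZ fl) normrM gtr0_norm ?invr_gt0//.
    rewrite ler_pdivlMl// => ex.
    have fMn : `|f (s (atom T g) n)| <= `|M|.
      apply: le_trans (fb _) _.
      apply: le_trans (ler_wpM2r (equiv_norm_ge0 HN _) (ler_norm M)) _.
      by rewrite ler_piMr//; have [] := sA g n.
    exists n => /=.
      rewrite -(ltr_nat R); apply: (@le_lt_trans _ _ (`|M| / e)); last exact: truncnS_gt.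
      rewrite ler_pdivlMr//; apply: le_trans (le_trans ex fMn).
      by rewrite ler_pM2r// ler_nat.
    exists (atom T g) => //; split; first by exists g.
    apply: le_trans ex; rewrite ler_peMl//; first exact: ltW.
    by rewrite ler1n.
  apply: bigcup_finite; first exact: finite_II.
  move=> n _; apply: finite_image.
  apply: (@atoms_finite _ _ _ T a b g0 Tc0 Tl a0 b0 Tab f M e (fun A => s A n) fM e0).
  by move=> g; exact: sA.
pose V : set X := [set x | forall e : R, 0 < e -> exists v, lin_span K v /\ N (x - v) < e].
have VD x y : V x -> V y -> V (x + y).
  move=> Vx Vy e e0; have e2 : 0 < e / 2 by rewrite divr_gt0.
  have [v [Kv xv]] := Vx _ e2; have [w [Kw yw]] := Vy _ e2.
  exists (v + w); split; first exact: lin_spanD.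
  have := equiv_normD HN (x - v) (y - w); rewrite /= -addrACA -opprD.
  by lra.
have Vatom g z : supported T (atom T g) z -> V z.
  move=> zs e e0; have [_ h] := sP _ (ex_intro _ g erefl).
  have [n [t zt]] := h z e zs e0.
  exists ((t * n.+1%:R) *: (n.+1%:R^-1 *: s (atom T g) n)); split.
    by apply: lin_spanZ; right; exists g, n.
  by rewrite scalerA -mulrA divff// mulr1.
move=> x e e0.
have ae : 0 < a * e / 2 by rewrite divr_gt0// mulr_gt0.
have [F FE] := finite_set_list (Tc0 x ae).
(* [B] is a finite union of atoms. The clause that [B] contains the atom of each of its points
   ensures that a newly added atom is disjoint from it. *)
have [y [B [Vy yE FB _]]] : exists y (B : set G), [/\ V y, T y = cutoff B (T x),
    forall g, List.In g F -> B g & forall g, B g -> atom T g `<=` B].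
  elim: F {FE} => [|g F [y [B [Vy yE FB Bat]]]].
    exists 0, set0; split=> //.
    - by move=> t t0; exists 0; split; [exact: lin_span0|have := equiv_norm0 HN; rewrite /= subrr => ->].
    - by apply/funext => g; rewrite cutoffF// (coord0 Tl).
  have [Bg|nBg] := pselect (B g).
    by exists y, B; split=> // h /= [<-//|]; exact: FB.
  have [z zE] := atom_invariant g0 Tc0 Tl a0 b0 Tab g x.
  exists (y + z), (B `|` atom T g); split.
  - apply: VD => //; apply: (Vatom g) => h nh; by rewrite zE cutoffF.
  - apply/funext => h; rewrite (coordD Tl) yE zE.
    have [gh|ngh] := pselect (atom T g h).
      rewrite (cutoffT _ gh) (@cutoffT _ _ (B `|` _)); last by right.
      rewrite cutoffF ?add0r// => Bh; apply: nBg; apply: (Bat h) => //.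
      rewrite (atom_eq g0 Tc0 Tl a0 b0 Tab gh); exact: atom_self.
    rewrite (cutoffF _ ngh) addr0; have [Bh|nBh] := pselect (B h).
      by rewrite !cutoffT//; left.
    by rewrite !cutoffF// => -[].
  - by move=> h /= [<-|/FB]; [right; exact: atom_self|left].
  - move=> h [Bh|gh] k hk; first by left; exact: (Bat h).
    by right; rewrite -(atom_eq g0 Tc0 Tl a0 b0 Tab gh).
have [v [Kv yv]] := Vy _ ae; exists v; split=> //.
have xy : N (x - y) <= a * e / 2.
  apply: (supnorm_le g0) => g; rewrite (coordB Tl) yE.
  have [Bg|nBg] := pselect (B g); first by rewrite cutoffT// subrr normr0 ltW.
  rewrite cutoffF// subr0 leNgt; apply/negP => h; apply: nBg; apply: FB.
  by apply/FE; exact: ltW.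
rewrite -(ltr_pM2l a0); have [h _] := Tab (x - v); apply: le_lt_trans h _.
have := equiv_normD HN (x - y) (y - v); rewrite /= addrA subrK; lra.
Qed.

End SubspaceOfC0WCG.

Theorem theorem4p4 (R : realType) (X : completeNormedModType R) :
  @density_omega1 R X ->
  ((@WCG R X /\ exists N : X -> R, equiv_norm N /\
       exists c : R, 0 < c /\ c <= 1 /\ LwsKK N c)
   <->
   (exists G : Type, card_omega1 G /\ iso_into_c0 X G)).
Proof.
move=> dX; split=> [[wX [N [HN [c [c0 [c1 HK]]]]]]|[G [[unc _] [T [Tc0 [Tl [a [b [a0 [b0 Tab]]]]]]]]]].
  exact: WCG_LwsKK_iso_into_c0 HN c0 c1 HK.
have [g0] : inhabited G.
  apply: contrapT => nG; apply: unc; rewrite (_ : [set: G] = set0)//.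
  by apply/seteqP; split=> // g _; apply: nG.
split; first exact: (subspace_c0_WCG g0 Tc0 Tl a0 b0 Tab).
exists (fun x => supnorm (T x)); split.
  exact: (supnorm_equiv_norm g0 Tc0 Tl a0 b0 Tab).
exists (1 / 2); split; first by rewrite divr_gt0.
split; first by lra.
exact: (supnorm_LwsKK g0 Tc0 Tl a0 b0 Tab).
Qed.
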